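(* Let $C_{\phi_1,\omega_1}$ and $C_{\phi_2,\omega_2}$ be densely defined weighted composition operators in $L^2(\mu)$. Then the pair $\mathbf{C}_{\phi,\omega}=(C_{\phi_1,\omega_1},C_{\phi_2,\omega_2})$ satisfies the following properties: (i) $\mathcal{D}(\mathbf{C}_{\phi,\omega})=L^2\big((1+h_{\phi_1,\omega_1}+h_{\phi_2,\omega_2})\,d\mu\big)$; (ii) $\overline{\mathcal{D}(\mathbf{C}_{\phi,\omega})}=L^2(\mu)$; (iii) the joint graph $\mathcal{G}(\mathbf{C}_{\phi,\omega})$ is closed; (iv) $\mathbf{C}_{\phi,\omega}^*=\overline{(C_{\phi_1,\omega_1}^*,C_{\phi_2,\omega_2}^* )}$, the closure of the row operator; (v) $\mathcal{D}(\mathbf{C}_{\phi,\omega}^* )=\Big\{\binom{f_1}{f_2}\in L^2(\mu)\oplus L^2(\mu):\ \sum_{i=1}^2 h_{\phi_i,\omega_i}\cdot E_{\phi_i,\omega_i}\big((f_i)_{\omega_i}\big)\circ\phi_i^{-1}\in L^2(\mu)\Big\}$.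
   Context: $(X,\mathscr{A},\mu)$ is a $\sigma$-finite measure space and $L^2(\mu)$ is the complex Hilbert space. For an $\mathscr{A}$-measurable transformation $\phi:X\to X$ (i.e. $\phi^{-1}(\Delta)\in\mathscr{A}$ for all $\Delta\in\mathscr{A}$) and an $\mathscr{A}$-measurable $\omega:X\to\mathbb{C}$, put $\mu_\omega(\Delta)=\int_\Delta|\omega|^2d\mu$. The weighted composition operator $C_{\phi,\omega}$ in $L^2(\mu)$ has domain $\mathcal{D}(C_{\phi,\omega})=\{f\in L^2(\mu):\omega\cdot(f\circ\phi)\in L^2(\mu)\}$ and acts by $C_{\phi,\omega}f=\omega\cdot(f\circ\phi)$. It is always assumed that $C_{\phi,\omega}$ is well-defined, i.e. $\mu_\omega\circ\phi^{-1}\ll\mu$. The Radon–Nikodym derivative $h_{\phi,\omega}:X\to[0,\infty]$ is the ($\mu$-a.e. unique) measurable function with $\mu_\omega(\phi^{-1}(\Delta))=\int_\Delta h_{\phi,\omega}\,d\mu$ for all $\Delta\in\mathscr{A}$. For measurable $\rho:X\to[1,\infty]$, $L^2(\rho\,d\mu)=\{f\in L^2(\mu):\int_X|f|^2\rho\,d\mu<\infty\}$ (with $0\cdot\infty=0$). If $C_{\phi,\omega}$ is densely defined, then $\mu_\omega|_{\phi^{-1}(\mathscr{A})}$ is $\sigma$-finite, and for measurable $f:X\to[0,\infty]$ or $f\in L^2(\mu_\omega)$, $E_{\phi,\omega}(f)$ is the conditional expectation: the ($\mu_\omega$-a.e. unique) $\phi^{-1}(\mathscr{A})$-measurable function with $\int_{\phi^{-1}(\Delta)}f\,d\mu_\omega=\int_{\phi^{-1}(\Delta)}E_{\phi,\omega}(f)\,d\mu_\omega$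 for all $\Delta\in\mathscr{A}$ (with $\mu_\omega(\phi^{-1}(\Delta))<\infty$ if $f\in L^2(\mu_\omega)$). $E_{\phi,\omega}(f)\circ\phi^{-1}$ denotes the ($\mu$-a.e. unique) $\mathscr{A}$-measurable function on $X$ that vanishes $\mu$-a.e. on $\{h_{\phi,\omega}=0\}$ and satisfies $(E_{\phi,\omega}(f)\circ\phi^{-1})\circ\phi=E_{\phi,\omega}(f)$ a.e. $[\mu_\omega]$. For $f\in L^2(\mu)$, $f_\omega=\chi_{\{\omega\neq0\}}\frac{f}{\omega}$ (which belongs to $L^2(\mu_\omega)$). A pair $\mathbf{C}_{\phi,\omega}=(C_{\phi_1,\omega_1},C_{\phi_2,\omega_2})$ is identified with the column operator $f\mapsto\binom{C_{\phi_1,\omega_1}f}{C_{\phi_2,\omega_2}f}$ from $L^2(\mu)$ into $L^2(\mu)\oplus L^2(\mu)$ with domain $\mathcal{D}(\mathbf{C}_{\phi,\omega})=\mathcal{D}(C_{\phi_1,\omega_1})\cap\mathcal{D}(C_{\phi_2,\omega_2})$; $\mathbf{C}_{\phi,\omega}^*$ is the adjoint of this column operator. The joint graph is $\mathcal{G}(\mathbf{C}_{\phi,\omega})=\{(f,C_{\phi_1,\omega_1}f,C_{\phi_2,\omega_2}f):f\in\mathcal{D}(\mathbf{C}_{\phi,\omega})\}\subseteq L^2(\mu)^3$. The row operator $(A_1,A_2)$ has domain $\mathcal{D}(A_1)\oplus\mathcal{D}(A_2)$ and maps $\binom{f_1}{f_2}$ to $A_1f_1+A_2f_2$. *)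

(* Defs.v *)
From HB Require Import structures.
From mathcomp Require Import all_boot all_order all_algebra.
From mathcomp Require Import all_classical all_reals all_analysis.
From mathcomp Require Import measurable_realfun.

Set Implicit Arguments.
Unset Strict Implicit.
Unset Printing Implicit Defensive.
Import Order.TTheory GRing.Theory Num.Theory.
Import numFieldNormedType.Exports.
(* Imported last: Re and Im must denote the projections of R[i]. *)
From mathcomp Require Import complex.
Import Normc.

Local Open Scope classical_set_scope.
Local Open Scope ring_scope.

(* R[i] carries the Borel sigma-algebra of the plane, transported along
   z |-> (Re z, Im z); see [measurable_complexP]. *)
HB.instance Definition _ (R : realType) := isPointed.Build R[i] 0.
HB.instance Definition _ (R : realType) := Measurable.copy R[i]
  (g_sigma_algebra_preimageType (fun z : R[i] => (Re z, Im z))).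

Section complex_measurable.
Context d (X : measurableType d) (R : realType).

Lemma measurable_complexP (f : X -> R[i]) : measurable_fun setT f <->
  measurable_fun setT (fun x => Re (f x)) /\
  measurable_fun setT (fun x => Im (f x)).
Proof.
have -> : measurable_fun setT f <->
    measurable_fun setT (fun x => (Re (f x), Im (f x))).
  split=> [mf _ B mB|mf _ _ [B mB <-]].
    apply: (mf measurableT ((fun z => (Re z, Im z)) @^-1` B)).
    by exists B => //; rewrite setTI.
  by rewrite (setTI (_ @^-1` B)); exact: mf.
exact: measurable_fun_pairP.
Qed.

Lemma measurable_normcB (f g : X -> R[i]) :
  measurable_fun setT f -> measurable_fun setT g ->
  measurable_fun setT (fun x => normc (f x - g x)).
Proof.
move=> /measurable_complexP[mRf mIf] /measurable_complexP[mRg mIg].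
rewrite (_ : (fun _ => _) = (fun x => Num.sqrt
    ((Re (f x) - Re (g x)) ^+ 2 + (Im (f x) - Im (g x)) ^+ 2))); last first.
  by apply/funext => x; case: (f x) => a b; case: (g x).
have /continuous_measurable_fun ms := @sqrt_continuous R.
apply: (measurableT_comp ms).
by apply: measurable_funD; apply: measurable_funX; exact: measurable_funB.
Qed.

Lemma measurable_normc (f : X -> R[i]) : measurable_fun setT f ->
  measurable_fun setT (fun x => normc (f x)).
Proof.
move=> mf; have := measurable_normcB mf (measurable_cst (0 : R[i])).
by under eq_fun do rewrite subr0.
Qed.

End complex_measurable.

Section square_integrable.
Context d (X : measurableType d) (R : realType).
Variable mu : {measure set X -> \bar R}.

Definition square_integrable (f : X -> R[i]) : Prop :=
  measurable_fun setT f /\ (\int[mu]_x ((normc (f x)) ^+ 2)%:E < +oo)%E.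

Definition complex_integrable (D : set X) (f : X -> R[i]) : Prop :=
  mu.-integrable D (fun x => (Re (f x))%:E) /\
  mu.-integrable D (fun x => (Im (f x))%:E).

Definition complex_integral (D : set X) (f : X -> R[i]) : R[i] :=
  Complex (Rintegral mu D (fun x => Re (f x)))
          (Rintegral mu D (fun x => Im (f x))).

Lemma Lnorm2E (f : X -> R) : 'N[mu]_2%:E[EFin \o f]%E =
  ((\int[mu]_x ((f x) ^+ 2)%:E) `^ 2^-1)%E.
Proof.
rewrite unlock; congr (_ `^ _)%E; apply: eq_integral => x _ /=.
by rewrite powR_mulrn// -normrX ger0_norm// sqr_ge0.
Qed.

Lemma square_integrable_Lnorm (f : X -> R[i]) : square_integrable f ->
  ('N[mu]_2%:E[EFin \o (fun x => normc (f x))] < +oo)%E.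
Proof. by move=> [_ foo]; rewrite Lnorm2E poweR_lty. Qed.

End square_integrable.

(* The Hilbert space L^2(mu): an element is an a.e. class of measurable
   functions X -> R[i]; it coerces to a chosen representative. *)
Record L2 d (X : measurableType d) (R : realType)
    (mu : {measure set X -> \bar R}) := MkL2 {
  L2_class :> {mfun_ mu, X >-> R[i]} ;
  L2_square_integrable : square_integrable mu L2_class }.

Section L2_space.
Context d (X : measurableType d) (R : realType).
Variable mu : {measure set X -> \bar R}.
Implicit Types f g : L2 mu.

Lemma L2_measurable f : measurable_fun setT f.
Proof. by case: (L2_square_integrable f). Qed.

Lemma L2P f g : f = g %[ae mu] -> f = g.
Proof.
case: f g => [f pf] [g pg] /= fg.
have e : f = g.
  rewrite -[f]reprK -[g]reprK.
  by apply/eqmodP/asboolP.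
by move: pf; rewrite e => pf; rewrite (Prop_irrelevance pf pg).
Qed.

HB.instance Definition _ := gen_eqMixin (L2 mu).
HB.instance Definition _ := gen_choiceMixin (L2 mu).

Let N (u v : X -> R[i]) := 'N[mu]_2%:E[EFin \o (fun x => normc (u x - v x)%R)]%E.

Definition L2_dist f g : R := fine (N f g).

Let N_triangle (u v w : X -> R[i]) : measurable_fun setT u ->
  measurable_fun setT v -> measurable_fun setT w ->
  (N u w <= N u v + N v w)%E.
Proof.
move=> mu_ mv mw; have muv := measurable_normcB mu_ mv.
have mvw := measurable_normcB mv mw.
apply: (@le_trans _ _ 'N[mu]_2%:E[EFin \o
    ((fun x => normc (u x - v x)) \+ (fun x => normc (v x - w x)))%R]%E);
  last by apply: minkowski_EFin => //; rewrite ler1n.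
rewrite /N Lnorm2E [leRHS]Lnorm2E; apply: gt0_ler_poweR => //.
- by rewrite in_itv/= leey andbT; apply: integral_ge0 => x _;
    rewrite lee_fin sqr_ge0.
- by rewrite in_itv/= leey andbT; apply: integral_ge0 => x _;
    rewrite lee_fin sqr_ge0.
apply: ge0_le_integral => //.
- by move=> x _; rewrite lee_fin sqr_ge0.
- by apply/measurable_EFinP/measurable_funX; exact: measurable_normcB.
- by apply/measurable_EFinP/measurable_funX; exact: measurable_funD.
have ge0 (z : R[i]) : 0 <= normc z by case: z => a b; exact: sqrtr_ge0.
move=> x _; rewrite lee_fin lerXn2r// ?nnegrE ?addr_ge0//=.
have -> : u x - w x = (u x - v x) + (v x - w x) by rewrite addrA subrK.
exact: le_normcD.
Qed.

Let N_fin f g : N f g \is a fin_num.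
Proof.
rewrite ge0_fin_numE ?Lnorm_ge0//.
apply: le_lt_trans.
  apply: (N_triangle (v := cst 0)) => //; exact: L2_measurable.
rewrite lte_add_pinfty// /N.
  rewrite (@eq_Lnorm _ _ _ _ _ _ (EFin \o (fun x => normc (f x)))).
    exact/square_integrable_Lnorm/L2_square_integrable.
  by move=> x /=; rewrite subr0.
rewrite (@eq_Lnorm _ _ _ _ _ _ (EFin \o (fun x => normc (g x)))).
  exact/square_integrable_Lnorm/L2_square_integrable.
by move=> x /=; rewrite sub0r normcN.
Qed.

Let L2_distxx f : L2_dist f f = 0.
Proof.
rewrite /L2_dist /N (@eq_Lnorm _ _ _ _ _ _ (cst 0%E)) ?Lnorm0//.
by move=> x /=; rewrite subrr normc0.
Qed.

Let L2_dist_positivity f g : L2_dist f g = 0 -> f = g.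
Proof.
move=> fg0; have N0 : N f g = 0%E by rewrite -(fineK (N_fin f g)) [fine _]fg0.
apply: L2P.
have mfg := measurable_normcB (@L2_measurable f) (@L2_measurable g).
have := Lnorm_eq0_eq0 _ _ N0; rewrite lte_fin ltr0n.
move=> /(_ ltac:(exact/measurable_EFinP) isT).
apply: filterS => x /= + _ => /(_ I) [/eq0_normc/eqP].
by rewrite subr_eq0 => /eqP.
Qed.

Let L2_dist_sym f g : L2_dist f g = L2_dist g f.
Proof.
by congr fine; apply: eq_Lnorm => x /=; rewrite -normcN opprB.
Qed.

Let L2_dist_triangle g f h : L2_dist f h <= L2_dist f g + L2_dist g h.
Proof.
rewrite /L2_dist -fineD ?N_fin// fine_le ?fin_numD ?N_fin//.
by apply: N_triangle; exact: L2_measurable.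
Qed.

HB.instance Definition _ := isMetric.Build R (L2 mu)
  L2_distxx L2_dist_positivity L2_dist_sym L2_dist_triangle.

Definition L2_inner f g : R[i] :=
  complex_integral mu setT (fun x => f x * (g x)^*%C).

End L2_space.
Arguments L2_inner {d X R} mu f g.

(* Linear operators are represented by their graphs.  The adjoint below is the
   graph of a function exactly when the domain of T is dense. *)
Section operators.
Context (R : realType).

Definition op_domain (U V : Type) (T : set (U * V)) : set U :=
  [set u | exists v, T (u, v)].

Definition op_adjoint (U V : Type) (innerU : U -> U -> R[i])
    (innerV : V -> V -> R[i]) (T : set (U * V)) : set (V * U) :=
  [set q | forall p, T p -> innerV p.2 q.1 = innerU p.1 q.2].

Context d (X : measurableType d) (mu : {measure set X -> \bar R}).

Definition L2_inner2 (p q : L2 mu * L2 mu) : R[i] :=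
  L2_inner mu p.1 q.1 + L2_inner mu p.2 q.2.

Definition op_column (A1 A2 : set (L2 mu * L2 mu)) :
    set (L2 mu * (L2 mu * L2 mu)) :=
  [set p | A1 (p.1, p.2.1) /\ A2 (p.1, p.2.2)].

Definition op_row (A1 A2 : set (L2 mu * L2 mu)) :
    set ((L2 mu * L2 mu) * L2 mu) :=
  [set p : (L2 mu * L2 mu) * L2 mu |
    exists g1 g2 : L2 mu, [/\ A1 (p.1.1, g1), A2 (p.1.2, g2) &
    (p.2 : X -> R[i]) = (fun x => g1 x + g2 x) %[ae mu]]].

Definition weighted_L2 (rho : X -> \bar R) : set (L2 mu) :=
  [set f | (\int[mu]_x (((normc (f x)) ^+ 2)%:E * rho x) < +oo)%E].

End operators.
Arguments L2_inner2 {R d X} mu p q.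
Arguments weighted_L2 {R d X} mu rho.

Section weighted_measure.
Context d (X : measurableType d) (R : realType).
Variables (mu : {measure set X -> \bar R}) (om : {mfun X >-> R[i]}).

Definition weighted_measure (A : set X) : \bar R :=
  (\int[mu]_(x in A) ((normc (om x)) ^+ 2)%:E)%E.

Let weighted_measure0 : weighted_measure set0 = 0%E.
Proof. by rewrite /weighted_measure integral_set0. Qed.

Let weighted_measure_ge0 A : (0 <= weighted_measure A)%E.
Proof. by apply: integral_ge0 => x _; rewrite lee_fin sqr_ge0. Qed.

Let weighted_measure_sigma_additive : semi_sigma_additive weighted_measure.
Proof.
apply: semi_sigma_additive_nng_induced => [|x]; last by rewrite lee_fin sqr_ge0.
by apply/measurable_EFinP/measurable_funX; exact: measurable_normc.
Qed.

HB.instance Definition _ := isMeasure.Build _ _ _ weighted_measure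
  weighted_measure0 weighted_measure_ge0 weighted_measure_sigma_additive.

End weighted_measure.

Section weighted_composition.
Context d (X : measurableType d) (R : realType).
Variables (mu : {measure set X -> \bar R}).
Variables (phi : {mfun X >-> X}) (om : {mfun X >-> R[i]}).

Definition wcomp_well_defined : Prop :=
  pushforward (weighted_measure mu om) phi `<< mu.

Definition wcomp_domain : set (L2 mu) :=
  [set f | square_integrable mu (fun x => om x * f (phi x))].

(* f (phi x) is computed with the representative of f; under
   [wcomp_well_defined] the result does not depend on it. *)
Definition wcomp : set (L2 mu * L2 mu) :=
  [set p : L2 mu * L2 mu | wcomp_domain p.1 /\
    (p.2 : X -> R[i]) = (fun x => om x * p.1 (phi x)) %[ae mu]].

Definition is_wcomp_RN (h : X -> \bar R) : Prop :=
  [/\ measurable_fun setT h, forall x, (0 <= h x)%E &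
      forall A, measurable A ->
        weighted_measure mu om (phi @^-1` A) = (\int[mu]_(x in A) h x)%E].

Definition wcomp_RN : X -> \bar R := xget (cst 0%E) [set h | is_wcomp_RN h].

Definition is_wcomp_condexp (f E : X -> R[i]) : Prop :=
  measurable_fun [set: g_sigma_algebra_preimageType phi] E /\
  forall A, measurable A ->
    (weighted_measure mu om (phi @^-1` A) < +oo)%E ->
    complex_integrable (weighted_measure mu om) (phi @^-1` A) E /\
    complex_integral (weighted_measure mu om) (phi @^-1` A) f =
    complex_integral (weighted_measure mu om) (phi @^-1` A) E.

Definition wcomp_condexp (f : X -> R[i]) : X -> R[i] :=
  xget (cst 0) [set E | is_wcomp_condexp f E].

(* g is the function written E o phi^-1. *)
Definition is_wcomp_pullback (E g : X -> R[i]) : Prop :=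
  [/\ measurable_fun setT g,
      {ae mu, forall x, wcomp_RN x = 0%E -> g x = 0} &
      {ae weighted_measure mu om, forall x, g (phi x) = E x}].

Definition wcomp_pullback (E : X -> R[i]) : X -> R[i] :=
  xget (cst 0) [set g | is_wcomp_pullback E g].

Definition wcomp_quotient (f : X -> R[i]) : X -> R[i] :=
  fun x => if om x == 0 then 0 else f x / om x.

(* h * (E(f_om) o phi^-1); [fine] only alters h where it is infinite, which is
   a mu-null set when the operator is densely defined. *)
Definition wcomp_adjoint_fun (f : X -> R[i]) : X -> R[i] :=
  fun x => (fine (wcomp_RN x))%:C%C *
           wcomp_pullback (wcomp_condexp (wcomp_quotient f)) x.

End weighted_composition.
Arguments wcomp_domain {d X R} mu phi om.
Arguments wcomp {d X R} mu phi om.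

(* Main.v *)
Require Import Defs.
From HB Require Import structures.
From mathcomp Require Import all_boot all_order all_algebra.
From mathcomp Require Import all_classical all_reals all_analysis.
From mathcomp Require Import measurable_realfun ring lra.
Import Order.TTheory GRing.Theory Num.Theory.
Import numFieldNormedType.Exports.
(* Imported last: Re and Im must denote the projections of R[i]. *)
From mathcomp Require Import complex.
Import Normc.
Set Implicit Arguments.
Unset Strict Implicit.
Unset Printing Implicit Defensive.
Local Open Scope classical_set_scope.
Local Open Scope ring_scope.

(** Fix one operator, with symbol phi and weight om, and let nu be the image
under phi of the weighted measure |om|^2 mu.  A change of variables gives
||om * (f o phi)||^2 = \int |f|^2 dnu, so the domain of the operator is
L^2(mu) /\ L^2(nu), and well-definedness says that nu << mu.  If the domain is
dense, then nu is sigma-finite ([dense_domain_sigma_finite]): the sets where a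
function of the domain is bounded below have finite nu-measure, and functions of
the domain approximate the indicators of an exhaustion of X.  Hence h = dnu/dmu
exists and is finite a.e., and the domain is L^2((1 + h) mu).  For the pair
this gives the weight 1 + h_1 + h_2.

Everything else rests on one formula ([wcomp_adjoint_formula]): with
H_f = h * (E(f_om) o phi^-1),

   \int om * (g o phi) * conj f dmu = \int g * conj H_f dmu

for all f in L^2(mu) and g in L^2(nu).  The reason is that E(f_om) is the
orthogonal projection of f_om, in L^2(|om|^2 mu), on the functions that factor
through phi.  The projection is constructed by hand ([projection]): for r >= 0
it is the density G of the image under phi of the measure r dm with respect to
the image of m, and G is in L^2 because the defining identity, applied to a
truncation of G itself, bounds \int G^2 by \int r^2.  Any conditional
expectation agrees a.e. with G o phi ([condexp_unique]), hence H_f = h G a.e.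

Let A_k be the set where both densities are at most k.  Cut off on A_k, any f in
L^2(mu) is in the domain of both operators, and any H_f is in L^2(mu).  The sets
A_k increase to X, so that cutting off on A_k, or on phi^-1(A_k), approximates
the identity in L^2 ([cutoff_cvg]).
 - The domain of the pair is therefore dense.
 - If f' is f cut off on phi^-1(A_k), then C^* f' is H_f cut off on A_k
   ([op_adjoint_cutoff]).  The inner product being continuous, every pair (g, v)
   in the closure of the graph of C satisfies <v, f'> = <g, C^* f'> for all
   these f', which forces v = om * (g o phi) on each phi^-1(A_k).  So the graph
   is closed.
 - Summing the formula over the two operators,
   <C g, (f_1, f_2)> = \int g * conj (H_{f_1} + H_{f_2}) for g in the domain of
   the pair.  If the sum H_{f_1} + H_{f_2} is square-integrable, it is thus the
   value of the adjoint at (f_1, f_2).  Conversely, testing against functions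
   that live on A_k shows that a value of the adjoint agrees with this sum on
   each A_k.  This describes the domain of the adjoint of the column.
 - If u is the value of this adjoint at (f_1, f_2), the functions f_i' are in the
   domains of the C_i^*, and the sum of the C_i^* f_i' is u cut off on A_k.
   Letting k tend to infinity, ((f_1, f_2), u) is a limit of points of the graph
   of the row operator; the converse inclusion is the continuity of the inner
   product.  *)

(** * Densities and images of measures *)

Section density.
Context d (T : measurableType d) (R : realType).
Variables (m n : {measure set T -> \bar R}) (h : T -> R).
Hypotheses (mh : measurable_fun setT h) (h0 : forall x, 0 <= h x).
Hypothesis nE : forall A, measurable A -> n A = (\int[m]_(x in A) (h x)%:E)%E.

Import HBNNSimple.

Let ge0_integral_density_nnsfun (s : {nnsfun T >-> R}) :
  (\int[n]_x (s x)%:E = \int[m]_x ((s x)%:E * (h x)%:E))%E.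
Proof.
have mhe : measurable_fun setT (EFin \o h) by exact/measurable_EFinP.
transitivity (\int[n]_x
   (\sum_(y \in range s) (y * \1_(s @^-1` [set y]) x)%:E))%E.
  by apply: eq_integral => t tE; rewrite /= fimfunE -fsumEFin.
have indic0 y x : (0 <= (y * \1_(s @^-1` [set y]) x)%:E)%E.
  exact: nnfun_muleindic_ge0.
have mindic r : measurable_fun setT (fun x => (r * \1_(s @^-1` [set r]) x)%:E).
  by apply/measurable_EFinP; exact: measurable_funM.
rewrite ge0_integral_fsum//.
transitivity (\int[m]_x (\sum_(y \in range s)
    (y * \1_(s @^-1` [set y]) x)%:E * (h x)%:E))%E; last first.
  apply: eq_integral => x _.
  rewrite -ge0_mule_fsuml => [|y]; last exact: nnfun_muleindic_ge0.
  by rewrite fsumEFin// -(fimfunE _ x).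
rewrite ge0_integral_fsum//; last 2 first.
  - by move=> y; apply: emeasurable_funM; first exact: mindic.
  - by move=> y x _; rewrite mule_ge0 ?lee_fin//; exact: indic0.
apply: eq_fsbigr => r rs.
have r0 : (0 <= r)%R by move: rs; rewrite inE => -[t _ <-].
rewrite integralZl_indic_nnsfun//.
under [RHS]eq_integral do rewrite EFinM -muleA.
rewrite ge0_integralZl//; last 2 first.
- by apply: emeasurable_funM => //; exact/measurable_EFinP.
- by move=> x _; rewrite mule_ge0 ?lee_fin.
congr (_ * _)%E; rewrite integral_indic// setIT nE//.
rewrite integral_mkcond; apply: eq_integral => x _.
by rewrite /patch indicE; case: ifPn => _; rewrite ?mul1e ?mul0e.
Qed.

(** Both sides are continuous along increasing sequences of simple functions; as
[h] is real-valued, multiplication by it is continuous on extended reals. *)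
Lemma ge0_integral_density (f : T -> \bar R) : measurable_fun setT f ->
  (forall x, 0 <= f x)%E -> (\int[n]_x f x = \int[m]_x (f x * (h x)%:E))%E.
Proof.
move=> mf f0; pose s := nnsfun_approx measurableT mf.
have fE x : f x = limn (EFin \o s^~ x).
  by apply/esym/cvg_lim => //; exact: cvg_nnsfun_approx.
have fhE x : (f x * (h x)%:E)%E = limn (fun k => ((s k x)%:E * (h x)%:E)%E).
  by apply/esym/cvg_lim => //; apply: cvgeZr => //; exact: cvg_nnsfun_approx.
under eq_integral do rewrite fE.
under [RHS]eq_integral do rewrite fhE.
have nds x k l : (k <= l)%N -> (s k x <= s l x)%R.
  by move=> kl; have /lefP/(_ x) := nd_nnsfun_approx measurableT mf kl.
rewrite monotone_convergence//=; last 3 first.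
- by move=> k; exact/measurable_EFinP.
- by move=> k x _; rewrite lee_fin.
- by move=> x _ k l kl; rewrite lee_fin; exact: nds.
rewrite monotone_convergence//=; last 3 first.
- by move=> k; apply: emeasurable_funM; exact/measurable_EFinP.
- by move=> k x _; rewrite mule_ge0 ?lee_fin.
- by move=> x _ k l kl; rewrite lee_wpmul2r ?lee_fin//; exact: nds.
by under eq_fun do rewrite ge0_integral_density_nnsfun.
Qed.

Lemma integral_density (f : T -> R) : measurable_fun setT f ->
  (\int[n]_x (f x)%:E = \int[m]_x (f x * h x)%:E)%E.
Proof.
move=> mf; have mfe : measurable_fun setT (EFin \o f) by exact/measurable_EFinP.
rewrite integralE [RHS]integralE.
rewrite !ge0_integral_density//; last 2 first.
- exact: measurable_funeneg.
- exact: measurable_funepos.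
by congr (_ - _)%E; apply: eq_integral => x _; rewrite ?funeposE ?funenegE;
  rewrite -?EFinN -!EFin_max -EFinM maxr_pMl// mul0r ?mulNr.
Qed.

Lemma integrable_density (f : T -> R) : measurable_fun setT f ->
  n.-integrable setT (EFin \o f) -> m.-integrable setT (fun x => (f x * h x)%:E).
Proof.
move=> mf /integrableP[mfe foo]; apply/integrableP; split.
  by apply/measurable_EFinP; exact: measurable_funM.
rewrite (ge0_integral_density _ _) in foo; last 2 first.
- exact: measurableT_comp.
- by move=> x.
under eq_integral do rewrite /= normrM (ger0_norm (h0 _)) EFinM.
by [].
Qed.

End density.

Section sigma_finite_radon_nikodym.
Context d (T : measurableType d) (R : realType).
Variables (mu : {sigma_finite_measure set T -> \bar R}).
Variables (nu : {measure set T -> \bar R}).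

(** The finite case is applied on each piece of a partition of the space into
sets of finite [nu]-measure, and the densities are glued.  Only one term of the
glued series is nonzero at a given point, so the density is real-valued. *)
Lemma sigma_finite_radon_nikodym : sigma_finite setT nu -> nu `<< mu ->
  exists h : T -> R, [/\ measurable_fun setT h, forall x, 0 <= h x &
    forall A, measurable A -> nu A = (\int[mu]_(x in A) (h x)%:E)%E].
Proof.
move=> [F TF /all_and2[mF nuFoo]] nu_mu.
pose E := seqDU F.
have mE k : measurable (E k).
  by apply: measurableD => //; exact: bigsetU_measurable.
have nuEoo k : (nu (E k) < +oo)%E.
  by rewrite (le_lt_trans _ (nuFoo k))// le_measure ?inE//; exact: subDsetl.
have UET : \bigcup_i E i = [set: T] by rewrite TF [RHS]seqDU_bigcup_eq.
have tE : trivIset setT E := trivIset_seqDU F.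
pose nu_ j : {finite_measure set T -> \bar R} := mfrestr (mE j) (nuEoo j).
have nu_mu_ k : nu_ k `<< mu.
  apply/null_content_dominatesP => S mS muS0.
  move/null_content_dominatesP : nu_mu; apply; first exact: measurableI.
  by apply/eqP; rewrite -measure_le0 -muS0 le_measure ?inE//; exact: measurableI.
have [g] := choice (fun j => radon_nikodym_sigma_finite (nu_mu_ j)).
move=> /all_and4[g0 gfin ig gE].
(* g j vanishes only a.e. outside E j, hence the explicit cut-off. *)
pose f j x := if x \in E j then g j x else 0%E.
have f0 j x : (0 <= f j x)%E by rewrite /f; case: ifP.
have mf j : measurable_fun setT (f j).
  apply: measurable_fun_if => //.
  - by apply: (measurable_fun_bool true); rewrite setTI preimage_mem_true.
  - by rewrite preimage_mem_true; apply: measurable_funTS; exact: measurable_int (ig j).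
pose s x : \bar R := (\sum_(j <oo) f j x)%E.
have ms : measurable_fun setT s by exact: ge0_emeasurable_sum.
have sfin x : s x \is a fin_num.
  have [k _ Ekx] : (\bigcup_i E i) x by rewrite UET.
  rewrite /s (@nneseriesD1 _ _ k)//= eseries0 ?adde0.
    by rewrite /f; case: ifP.
  move=> j _ /= jk; rewrite /f memNset// => Ejx.
  by move: jk; rewrite (tE j k) ?eqxx//; exists x.
exists (fine \o s); split=> [|x|A mA].
- by apply: measurableT_comp => //; exact: measurable_fine.
- by apply: fine_ge0; exact: nneseries_ge0.
under eq_integral do rewrite /= fineK//.
rewrite integral_nneseries//; last by move=> k; exact: measurable_funTS.
have -> : nu A = (\sum_(k <oo) nu (A `&` E k))%E.
  rewrite -{1}[A]setIT -UET setI_bigcupr measure_bigcup//.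
  - by apply: eq_eseriesl => k; rewrite in_setT.
  - by move=> k _; exact: measurableI.
  - exact: trivIset_setIl.
apply: eq_eseriesr => k _.
transitivity (nu_ k (A `&` E k)).
  by rewrite /nu_/= /mfrestr /mrestr -setIA setIid.
rewrite gE; last exact: measurableI.
rewrite integral_mkcondr; apply: eq_integral => x _.
by rewrite /patch /f.
Qed.

End sigma_finite_radon_nikodym.

Section measure_constructions.
Context d (T : measurableType d) (R : realType) (m : {measure set T -> \bar R}).

Lemma density_measure_exists (r : T -> R) : measurable_fun setT r ->
    (forall x, 0 <= r x) -> exists n : {measure set T -> \bar R},
  forall A, n A = (\int[m]_(x in A) (r x)%:E)%E.
Proof.
move=> mr r0; pose n A := (\int[m]_(x in A) (r x)%:E)%E.
have n0 : n set0 = 0%E by rewrite /n integral_set0.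
have nge0 A : (0 <= n A)%E by apply: integral_ge0 => x _; rewrite lee_fin.
have ns : semi_sigma_additive n.
  by apply: semi_sigma_additive_nng_induced => //; exact/measurable_EFinP.
by exists (HB.pack_for {measure set T -> \bar R} n
  (isMeasure.Build _ _ _ n n0 nge0 ns)).
Qed.

Lemma image_measure_exists d' (Y : measurableType d') (phi : {mfun T >-> Y}) :
  exists n : {measure set Y -> \bar R}, forall A, n A = m (phi @^-1` A).
Proof.
by exists (measure_function_pushforward__canonical__measure_function_Measure
  m (@measurable_funPT _ _ _ _ phi)).
Qed.

End measure_constructions.

(** * Real square-integrable functions and the projection on functions of phi *)

Section real_square_integrable.
Context d (T : measurableType d) (R : realType) (m : {measure set T -> \bar R}).
Implicit Types f g : T -> R.

Definition real_square_integrable f :=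
  measurable_fun setT f /\ (\int[m]_x (f x ^+ 2)%:E < +oo)%E.

Lemma measurable_sqrE f : measurable_fun setT f ->
  measurable_fun setT (fun x => (f x ^+ 2)%:E).
Proof. by move=> mf; apply/measurable_EFinP; exact: measurable_funX. Qed.

Lemma le_real_square_integrable f g : measurable_fun setT f ->
  (forall x, f x ^+ 2 <= g x ^+ 2) ->
  real_square_integrable g -> real_square_integrable f.
Proof.
move=> mf fg [mg g2]; split => //; apply: le_lt_trans g2.
apply: ge0_le_integral => //.
- by move=> x _; rewrite lee_fin sqr_ge0.
- exact: measurable_sqrE.
- exact: measurable_sqrE.
- by move=> x _; rewrite lee_fin.
Qed.

Lemma real_square_integrableB f g : real_square_integrable f ->
  real_square_integrable g -> real_square_integrable (fun x => f x - g x).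
Proof.
move=> [mf f2] [mg g2]; split; first exact: measurable_funB.
have mf2 := measurable_sqrE mf; have mg2 := measurable_sqrE mg.
have s0 (u : T -> R) x : (0 <= (u x ^+ 2)%:E)%E by rewrite lee_fin sqr_ge0.
apply: (@le_lt_trans _ _
    (\int[m]_x (2%:E * ((f x ^+ 2)%:E + (g x ^+ 2)%:E)))%E).
  apply: ge0_le_integral => //.
  - by move=> x _; exact: (s0 (fun x => f x - g x)).
  - by apply: measurable_sqrE; exact: measurable_funB.
  - by apply: measurable_funeM; exact: emeasurable_funD.
  - move=> x _; rewrite -EFinD -EFinM lee_fin -subr_ge0.
    by have := sqr_ge0 (f x + g x); lra.
rewrite ge0_integralZl//; last 2 first.
- exact: emeasurable_funD.
- by move=> x _; exact: adde_ge0.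
by rewrite ge0_integralD// lte_mul_pinfty// lte_add_pinfty.
Qed.

Lemma real_square_integrable_pos f : real_square_integrable f ->
  real_square_integrable f^\+.
Proof.
move=> f2; apply: le_real_square_integrable (f2).
  by apply: measurable_funrpos; case: f2.
move=> x; rewrite /funrpos; case: (leP (f x) 0) => // _.
by rewrite expr0n sqr_ge0.
Qed.

Lemma real_square_integrable_neg f : real_square_integrable f ->
  real_square_integrable f^\-.
Proof.
move=> f2; apply: le_real_square_integrable (f2).
  by apply: measurable_funrneg; case: f2.
move=> x; rewrite /funrneg; case: (leP (- f x) 0) => _.
  by rewrite expr0n sqr_ge0.
by rewrite sqrrN.
Qed.

Lemma real_square_integrableM f g :
  real_square_integrable f -> real_square_integrable g ->
  m.-integrable setT (fun x => (f x * g x)%:E).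
Proof.
move=> [mf f2] [mg g2].
have mfg : measurable_fun setT (fun x => (f x * g x)%:E).
  by apply/measurable_EFinP; exact: measurable_funM.
have mf2 := measurable_sqrE mf; have mg2 := measurable_sqrE mg.
have s0 (u : T -> R) x : (0 <= (u x ^+ 2)%:E)%E by rewrite lee_fin sqr_ge0.
apply/integrableP; split => //.
apply: (@le_lt_trans _ _ (\int[m]_x ((f x ^+ 2)%:E + (g x ^+ 2)%:E))%E).
  apply: ge0_le_integral => //.
  - exact: measurableT_comp.
  - exact: emeasurable_funD.
  - move=> x _; rewrite -EFinD lee_fin normrM.
    rewrite -[f x ^+ 2]real_normK ?num_real// -[g x ^+ 2]real_normK ?num_real//.
    rewrite -subr_ge0; have := sqr_ge0 (`|f x| - `|g x|).
    have := mulr_ge0 (normr_ge0 (f x)) (normr_ge0 (g x)).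
    move: `|f x| `|g x| => a b; nra.
by rewrite ge0_integralD// lte_add_pinfty.
Qed.

(** Reduces an integral of a product to products of nonnegative functions, for
which integrals against densities and images can be rewritten without any
integrability condition. *)
Lemma integral_posnegM f g :
  real_square_integrable f -> real_square_integrable g ->
  (\int[m]_x (f x * g x)%:E =
   (\int[m]_x (f^\+ x * g^\+ x)%:E + \int[m]_x (f^\- x * g^\- x)%:E) -
   (\int[m]_x (f^\+ x * g^\- x)%:E + \int[m]_x (f^\- x * g^\+ x)%:E))%E.
Proof.
move=> f2 g2.
have fp := real_square_integrable_pos f2.
have fn := real_square_integrable_neg f2.
have gp := real_square_integrable_pos g2.
have gn := real_square_integrable_neg g2.
have ipp := real_square_integrableM fp gp.
have inn := real_square_integrableM fn gn.
have ipn := real_square_integrableM fp gn.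
have inp := real_square_integrableM fn gp.
rewrite -!integralD// -integralB//; [|exact: integrableD..].
apply: eq_integral => x _ /=.
rewrite -!EFinD; congr EFin.
rewrite -{1}(funrposBneg f) -{1}(funrposBneg g) !fctE; ring.
Qed.

End real_square_integrable.

Section image_measure.
Context d d' (X : measurableType d) (Y : measurableType d') (R : realType).
Variables (m : {measure set X -> \bar R}) (phi : {mfun X >-> Y}).
Variable nu : {measure set Y -> \bar R}.
Hypothesis nuE : forall A, measurable A -> nu A = m (phi @^-1` A).

Lemma ge0_integral_image (f : Y -> \bar R) : measurable_fun setT f ->
  (forall y, 0 <= f y)%E -> (\int[nu]_y f y = \int[m]_x f (phi x))%E.
Proof.
move=> mf f0; rewrite -(@preimage_setT X Y phi).
rewrite -(ge0_integral_pushforward (@measurable_funPT _ _ _ _ phi))//.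
by apply: eq_measure_integral => A mA _; exact: nuE.
Qed.

Lemma integral_image (k : Y -> R) : measurable_fun setT k ->
  (\int[nu]_y (k y)%:E = \int[m]_x (k (phi x))%:E)%E.
Proof.
move=> mk; have mke : measurable_fun setT (EFin \o k) by exact/measurable_EFinP.
rewrite integralE [RHS]integralE.
rewrite (ge0_integral_image (measurable_funepos mke))//.
rewrite (ge0_integral_image (measurable_funeneg mke))//.
by congr (_ - _)%E; apply: eq_integral => x _; rewrite ?funeposE ?funenegE.
Qed.

Lemma real_square_integrable_image (f : Y -> R) : real_square_integrable nu f ->
  real_square_integrable m (f \o phi).
Proof.
move=> [mf f2]; split; first exact: measurableT_comp.
have -> // := esym (@ge0_integral_image (fun y => (f y ^+ 2)%:E) _ _).
- exact: measurable_sqrE.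
- by move=> y; rewrite lee_fin sqr_ge0.
Qed.

Hypothesis nu_sfin : sigma_finite setT nu.

(** [G] is the density, with respect to [nu], of the image under [phi] of the
measure [r dm].  That [G] is in L^2: for a truncation g of [G], of
finite square integral I, the identity for 2 g reads
2 I = \int 2 g(phi) r <= \int g(phi)^2 + \int r^2 = I + \int r^2, so that
I <= \int r^2, and the truncations increase to [G]. *)
Lemma ge0_projection (r : X -> R) : measurable_fun setT r ->
    (forall x, 0 <= r x) -> (\int[m]_x (r x ^+ 2)%:E < +oo)%E ->
  exists G : Y -> R, [/\ measurable_fun setT G, forall y, 0 <= G y,
    (\int[nu]_y (G y ^+ 2)%:E < +oo)%E &
    forall g : Y -> R, measurable_fun setT g -> (forall y, 0 <= g y) ->
      (\int[m]_x (g (phi x) * r x)%:E = \int[nu]_y (g y * G y)%:E)%E].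
Proof.
move=> mr r0 r2.
have mr2 : measurable_fun setT (fun x => (r x ^+ 2)%:E).
  by apply/measurable_EFinP; exact: measurable_funX.
have [rm rmE] := density_measure_exists m mr r0.
have [lam lamE] := image_measure_exists rm phi.
have mphi A : measurable A -> measurable (phi @^-1` A).
  by move=> mA; rewrite -[X in measurable X]setTI; exact: measurable_funPT.
have lam_nu : lam `<< nu.
  apply/null_content_dominatesP => A mA nuA.
  rewrite lamE rmE null_set_integral//; first exact: mphi.
    by apply: measurable_funTS; exact/measurable_EFinP.
  by rewrite -nuE.
have /sigma_finiteP[F [TF ndF /all_and2[mF nuF']]] := nu_sfin.
have nuF k : (nu (F k) < +oo)%E := nuF' k.
have lam_sfin : sigma_finite setT lam.
  exists F => // k; split => //; rewrite lamE rmE.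
  have mphiF := mphi _ (mF k).
  apply: (@le_lt_trans _ _ (\int[m]_(x in phi @^-1` F k) (1 + (r x ^+ 2)%:E))%E).
    apply: ge0_le_integral => //.
    - by move=> x _; rewrite lee_fin.
    - by apply: measurable_funTS; exact/measurable_EFinP.
    - by apply: emeasurable_funD => //; exact: measurable_funTS.
    - by move=> x _; rewrite -EFinD lee_fin; have := sqr_ge0 (r x - 1); nra.
  rewrite ge0_integralD//; last 2 first.
  - by move=> x _; rewrite lee_fin sqr_ge0.
  - exact: measurable_funTS.
  rewrite integral_cst// mul1e.
  rewrite lte_add_pinfty//.
    by have := nuF k; rewrite nuE.
  apply: le_lt_trans r2; apply: ge0_subset_integral => //.
  by move=> x _; rewrite lee_fin sqr_ge0.
pose nu' := HB.pack_for {sigma_finite_measure set Y -> \bar R} (Measure.sort nu)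
  (isSFinite.Build _ _ _ _ (sfinite_measure_sigma_finite nu_sfin))
  (isSigmaFinite.Build _ _ _ _ nu_sfin).
have [G [mG G0 lamG]] := @sigma_finite_radon_nikodym _ _ _ nu' lam lam_sfin lam_nu.
have GE (g : Y -> R) : measurable_fun setT g -> (forall y, 0 <= g y) ->
    (\int[m]_x (g (phi x) * r x)%:E = \int[nu]_y (g y * G y)%:E)%E.
  move=> mg g0; have mge : measurable_fun setT (EFin \o g) by exact/measurable_EFinP.
  transitivity (\int[rm]_x (g (phi x))%:E)%E.
    have mgphi : measurable_fun setT (fun x => (g (phi x))%:E).
      by apply: (measurableT_comp mge); exact: measurable_funPT.
    rewrite (ge0_integral_density mr r0 (fun A _ => rmE A) mgphi); last first.
      by move=> x; rewrite lee_fin.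
    by under [RHS]eq_integral do rewrite -EFinM.
  transitivity (\int[lam]_y (g y)%:E)%E.
    rewrite -(@preimage_setT X Y phi) -(ge0_integral_pushforward
      (@measurable_funPT _ _ _ _ phi) rm (f := EFin \o g))//; last first.
      by move=> y _; rewrite lee_fin.
    by apply: eq_measure_integral => A mA _; exact/esym/lamE.
  rewrite (ge0_integral_density mG G0 lamG mge); last by move=> y; rewrite lee_fin.
  by under eq_integral do rewrite -EFinM.
(* The truncation sets: G is bounded on B k, and B k has finite measure. *)
pose B k := F k `&` [set y | G y <= k%:R].
have mB k : measurable (B k).
  apply: measurableI => //; rewrite -[X in measurable X]setTI.
  exact: measurable_fun_le.
have TB : \bigcup_k B k = setT.
  rewrite -subTset => y _; have : (\bigcup_i F i) y by rewrite -TF.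
  move=> [i _ Fiy]; exists (maxn i (Num.truncn (G y)).+1) => //; split.
    by have /subsetPset := ndF _ _ (leq_maxl i (Num.truncn (G y)).+1); exact.
  rewrite /= (le_trans (ltW (truncnS_gt (G y))))// ler_nat.
  exact: leq_maxr.
have ndB : nondecreasing_seq B.
  move=> i j ij; apply/subsetPset => y [Fiy Gy]; split.
    by have /subsetPset := ndF _ _ ij; exact.
  by rewrite /= (le_trans Gy)// ler_nat.
have mG2 : measurable_fun setT (fun x => (G x ^+ 2)%:E).
  by apply/measurable_EFinP; exact: measurable_funX.
have intB k : (\int[nu]_(y in B k) (G y ^+ 2)%:E <= \int[m]_x (r x ^+ 2)%:E)%E.
  pose g y : R := G y * \1_(B k) y.
  have mg : measurable_fun setT g by exact: measurable_funM.
  have g0 y : 0 <= g y by rewrite mulr_ge0.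
  have gG y : g y * G y = g y ^+ 2.
    by rewrite /g indicE; case: (y \in B k); rewrite ?mulr1 ?mulr0 ?mul0r ?expr0n// expr2.
  have mg2 : measurable_fun setT (fun y => (g y ^+ 2)%:E).
    by apply/measurable_EFinP; exact: measurable_funX.
  have IE : (\int[nu]_(y in B k) (G y ^+ 2)%:E = \int[nu]_y (g y ^+ 2)%:E)%E.
    rewrite integral_mkcond; apply: eq_integral => y _.
    by rewrite /patch /g indicE; case: ifP; rewrite ?mulr1 ?mulr0 ?expr0n.
  have Ifin : (\int[nu]_y (g y ^+ 2)%:E)%E \is a fin_num.
    rewrite -IE ge0_fin_numE; last first.
      by apply: integral_ge0 => y _; rewrite lee_fin sqr_ge0.
    apply: (@le_lt_trans _ _ (\int[nu]_(y in B k) (cst (k%:R ^+ 2)%:E y))%E).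
      apply: ge0_le_integral => //.
      - by move=> y _; rewrite lee_fin sqr_ge0.
      - exact: measurable_funTS.
      - by move=> y [_ Gk]; rewrite lee_fin lerXn2r ?nnegrE.
    rewrite integral_cst// lte_mul_pinfty ?lee_fin ?sqr_ge0//.
    by rewrite (le_lt_trans _ (nuF k))// le_measure ?inE//; exact: subIsetl.
  rewrite IE -(leeD2lE _ _ Ifin).
  rewrite -ge0_integralD//; last 2 first.
  - by move=> y _; rewrite lee_fin sqr_ge0.
  - by move=> y _; rewrite lee_fin sqr_ge0.
  rewrite (eq_integral (fun y => ((2 * g y) * G y)%:E)); last first.
    by move=> y _; rewrite -mulrA gG -EFinD mulr_natl mulr2n.
  rewrite -GE; last 2 first.
  - exact: measurable_funM.
  - by move=> y; rewrite mulr_ge0.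
  have mgphi : measurable_fun setT (g \o phi).
    by apply: measurableT_comp => //; exact: measurable_funPT.
  have mgphi2 : measurable_fun setT (fun x => (g (phi x) ^+ 2)%:E).
    by apply/measurable_EFinP; exact: measurable_funX.
  rewrite ge0_integral_image//; last by move=> y; rewrite lee_fin sqr_ge0.
  rewrite -ge0_integralD//; last 2 first.
  - by move=> y _; rewrite lee_fin sqr_ge0.
  - by move=> y _; rewrite lee_fin sqr_ge0.
  apply: ge0_le_integral => //.
  - by move=> x _; rewrite lee_fin !mulr_ge0.
  - apply/measurable_EFinP; apply: measurable_funM => //.
    exact: measurable_funM.
  - exact: emeasurable_funD.
  - move=> x _; rewrite -EFinD lee_fin -subr_ge0.
    by have := sqr_ge0 (g (phi x) - r x); rewrite sqrrB; lra.
exists G; split => //; rewrite (le_lt_trans _ r2)// -TB.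
have cv := @ge0_nondecreasing_set_cvg_integral _ _ _ B
  (fun y => (G y ^+ 2)%:E) nu ndB mB.
rewrite -(cvg_lim _ (cv _ _))//.
- apply: lime_le; last exact: nearW.
  apply: cvgP; apply: cv.
  + by move=> i; exact: measurable_funTS.
  + by move=> i y _; rewrite lee_fin sqr_ge0.
- by move=> i; exact: measurable_funTS.
- by move=> i y _; rewrite lee_fin sqr_ge0.
Qed.

(** The function [G \o phi] is the orthogonal projection of [r], in L^2(m), on
the closed subspace of the functions of the form [g \o phi]. *)
Lemma projection (r : X -> R) : real_square_integrable m r ->
  exists2 G : Y -> R, real_square_integrable nu G &
    forall g : Y -> R, real_square_integrable nu g ->
      (\int[m]_x (g (phi x) * r x)%:E = \int[nu]_y (g y * G y)%:E)%E.
Proof.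
move=> r2.
have [mrp rp2] := real_square_integrable_pos r2.
have [mrn rn2] := real_square_integrable_neg r2.
have [G1 [mG1 G10 G12 G1E]] := ge0_projection mrp (funrpos_ge0 r) rp2.
have [G2 [mG2 G20 G22 G2E]] := ge0_projection mrn (funrneg_ge0 r) rn2.
exists (fun y => G1 y - G2 y); first exact: real_square_integrableB.
move=> g g2; have [mgp gp2] := real_square_integrable_pos g2.
have [mgn gn2] := real_square_integrable_neg g2.
rewrite (integral_posnegM (f := g \o phi))//; last first.
  exact: real_square_integrable_image.
have g0p := funrpos_ge0 g; have g0n := funrneg_ge0 g.
transitivity ((\int[nu]_y (g^\+ y * G1 y)%:E + \int[nu]_y (g^\- y * G2 y)%:E) -
   (\int[nu]_y (g^\+ y * G2 y)%:E + \int[nu]_y (g^\- y * G1 y)%:E))%E.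
  by rewrite -!G1E// -!G2E.
have igp G : real_square_integrable nu G ->
  nu.-integrable setT (fun y => (g^\+ y * G y)%:E).
  by move=> G2'; exact: real_square_integrableM.
have ign G : real_square_integrable nu G ->
  nu.-integrable setT (fun y => (g^\- y * G y)%:E).
  by move=> G2'; exact: real_square_integrableM.
have ip1 := igp G1 (conj mG1 G12); have ip2 := igp G2 (conj mG2 G22).
have in1 := ign G1 (conj mG1 G12); have in2 := ign G2 (conj mG2 G22).
rewrite -!integralD// -integralB//; [|exact: integrableD..].
apply: eq_integral => y _ /=.
rewrite -!EFinD; congr EFin.
rewrite -[in RHS](funrposBneg g) !fctE; ring.
Qed.

End image_measure.

(** * Square-integrable complex functions *)

Section complex_functions.
Context d (X : measurableType d) (R : realType).
Variable mu : {measure set X -> \bar R}.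
Implicit Types f g : X -> R[i].

Lemma normc_sqr (z : R[i]) : normc z ^+ 2 = Re z ^+ 2 + Im z ^+ 2.
Proof. by case: z => a b; rewrite /= sqr_sqrtr// addr_ge0 ?sqr_ge0. Qed.

Lemma Re_mulC (z w : R[i]) : Re (z * w^*%C) = Re z * Re w + Im z * Im w.
Proof. by case: z w => a b [c e] /=; rewrite mulrN opprK. Qed.

Lemma Im_mulC (z w : R[i]) : Im (z * w^*%C) = Im z * Re w - Re z * Im w.
Proof. by case: z w => a b [c e] /=; rewrite mulrN addrC. Qed.

Lemma normc_sqrM (z w : R[i]) : normc (z * w) ^+ 2 = normc z ^+ 2 * normc w ^+ 2.
Proof. by rewrite !normc_sqr; case: z w => a b [c e] /=; ring. Qed.

Lemma mulcJ (z : R[i]) : z * z^*%C = (normc z ^+ 2)%:C%C.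
Proof.
by rewrite normc_sqr; case: z => a b; congr Complex => /=; ring.
Qed.

Lemma conjc_scale (r : R) (z : R[i]) : (r%:C%C * z)^*%C = r%:C%C * z^*%C.
Proof. by rewrite rmorphM; congr (_ * _); exact: conjc_real. Qed.

Lemma measurable_Re f : measurable_fun setT f ->
  measurable_fun setT (fun x => Re (f x)).
Proof. by move=> /measurable_complexP[]. Qed.

Lemma measurable_Im f : measurable_fun setT f ->
  measurable_fun setT (fun x => Im (f x)).
Proof. by move=> /measurable_complexP[]. Qed.

Lemma measurable_cD f g : measurable_fun setT f -> measurable_fun setT g ->
  measurable_fun setT (fun x => f x + g x).
Proof.
move=> mf mg; apply/measurable_complexP; split.
- rewrite (_ : (fun _ => _) = (fun x => Re (f x) + Re (g x))).
    by apply: measurable_funD; exact: measurable_Re.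
  by apply/funext => x; case: (f x) (g x) => a b [].
- rewrite (_ : (fun _ => _) = (fun x => Im (f x) + Im (g x))).
    by apply: measurable_funD; exact: measurable_Im.
  by apply/funext => x; case: (f x) (g x) => a b [].
Qed.

Lemma measurable_cM f g : measurable_fun setT f -> measurable_fun setT g ->
  measurable_fun setT (fun x => f x * g x).
Proof.
move=> mf mg; apply/measurable_complexP; split.
- rewrite (_ : (fun _ => _) = (fun x => Re (f x) * Re (g x) - Im (f x) * Im (g x))).
    by apply: measurable_funB; apply: measurable_funM;
      [exact: measurable_Re..|exact: measurable_Im|exact: measurable_Im].
  by apply/funext => x; case: (f x) (g x) => a b [].
- rewrite (_ : (fun _ => _) = (fun x => Re (f x) * Im (g x) + Im (f x) * Re (g x))).
    by apply: measurable_funD; apply: measurable_funM;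
      do ?[exact: measurable_Re|exact: measurable_Im].
  by apply/funext => x; case: (f x) (g x) => a b [].
Qed.

Lemma measurable_cconj f : measurable_fun setT f ->
  measurable_fun setT (fun x => (f x)^*%C).
Proof.
move=> mf; apply/measurable_complexP; split.
- rewrite (_ : (fun _ => _) = (fun x => Re (f x))); first exact: measurable_Re.
  by apply/funext => x; case: (f x).
- rewrite (_ : (fun _ => _) = (fun x => - Im (f x))).
    by apply: measurableT_comp => //; exact: measurable_Im.
  by apply/funext => x; case: (f x).
Qed.

Lemma measurable_cB f g : measurable_fun setT f -> measurable_fun setT g ->
  measurable_fun setT (fun x => f x - g x).
Proof.
move=> mf mg; apply/measurable_complexP; split.
- rewrite (_ : (fun _ => _) = (fun x => Re (f x) - Re (g x))).
    by apply: measurable_funB; exact: measurable_Re.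
  by apply/funext => x; case: (f x) (g x) => a b [].
- rewrite (_ : (fun _ => _) = (fun x => Im (f x) - Im (g x))).
    by apply: measurable_funB; exact: measurable_Im.
  by apply/funext => x; case: (f x) (g x) => a b [].
Qed.

Lemma measurable_real_complex (r : X -> R) : measurable_fun setT r ->
  measurable_fun setT (fun x => (r x)%:C%C).
Proof. by move=> mr; apply/measurable_complexP; split. Qed.

Lemma square_integrableP f : square_integrable mu f <->
  real_square_integrable mu (fun x => Re (f x)) /\
  real_square_integrable mu (fun x => Im (f x)).
Proof.
split.
  move=> [mf f2]; have mn := measurable_sqrE (measurable_normc mf).
  have [mR mI] := (measurable_Re mf, measurable_Im mf).
  split; (split => //; apply: le_lt_trans f2; apply: ge0_le_integral => //;
    [by move=> x _; rewrite lee_fin sqr_ge0|exact: measurable_sqrE|];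
    move=> x _; rewrite lee_fin normc_sqr).
  - by rewrite lerDl sqr_ge0.
  - by rewrite lerDr sqr_ge0.
move=> [[mR fR] [mI fI]]; split; first exact/measurable_complexP.
under eq_integral do rewrite normc_sqr EFinD.
have mR2 := measurable_sqrE mR; have mI2 := measurable_sqrE mI.
rewrite ge0_integralD//; first exact: lte_add_pinfty.
- by move=> x _; rewrite lee_fin sqr_ge0.
- by move=> x _; rewrite lee_fin sqr_ge0.
Qed.

Lemma le_square_integrable f g : measurable_fun setT f ->
  (forall x, normc (f x) ^+ 2 <= normc (g x) ^+ 2) ->
  square_integrable mu g -> square_integrable mu f.
Proof.
move=> mf fg [mg g2].
have [] := @le_real_square_integrable _ _ _ mu
  (fun x => normc (f x)) (fun x => normc (g x)) _ fg.
- exact: measurable_normc.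
- by split => //; exact: measurable_normc.
- by [].
Qed.

Lemma square_integrableB f g : square_integrable mu f ->
  square_integrable mu g -> square_integrable mu (fun x => f x - g x).
Proof.
move=> /square_integrableP[fR fI] /square_integrableP[gR gI].
apply/square_integrableP; split.
- rewrite (_ : (fun _ => _) = (fun x => Re (f x) - Re (g x))).
    exact: real_square_integrableB.
  by apply/funext => x; case: (f x) (g x) => a b [].
- rewrite (_ : (fun _ => _) = (fun x => Im (f x) - Im (g x))).
    exact: real_square_integrableB.
  by apply/funext => x; case: (f x) (g x) => a b [].
Qed.

Lemma square_integrableD f g : square_integrable mu f ->
  square_integrable mu g -> square_integrable mu (fun x => f x + g x).
Proof.
move=> f2 g2; have gN : square_integrable mu (fun x => - g x).
  apply: le_square_integrable (g2); last by move=> x; rewrite normcN.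
  have [mg _] := g2.
  rewrite (_ : (fun x => - g x) = (fun x => cst 0 x - g x)).
    exact: measurable_cB.
  by apply/funext => x; rewrite sub0r.
rewrite (_ : (fun x => _) = (fun x => f x - - g x)).
  exact: square_integrableB.
by apply/funext => x; rewrite opprK.
Qed.

Lemma ae_square_integrable f g : measurable_fun setT g -> f = g %[ae mu] ->
  square_integrable mu f -> square_integrable mu g.
Proof.
move=> mg fg [mf f2]; split => //.
rewrite -(@ge0_ae_eq_integral _ _ _ mu setT (fun x => (normc (f x) ^+ 2)%:E))//.
- by apply: measurable_sqrE; exact: measurable_normc.
- by apply: measurable_sqrE; exact: measurable_normc.
- by move=> x _; rewrite lee_fin sqr_ge0.
- by move=> x _; rewrite lee_fin sqr_ge0.
- by apply: filterS fg => x /= /(_ I) -> _.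
Qed.

Definition cutoff (A : set X) f x := if x \in A then f x else 0.

Lemma measurable_cutoff A f : measurable A -> measurable_fun setT f ->
  measurable_fun setT (cutoff A f).
Proof.
move=> mA mf; apply: measurable_fun_if => //; last exact: measurable_funTS.
by apply: (measurable_fun_bool true); rewrite setTI preimage_mem_true.
Qed.

Lemma normc_cutoff A f x : normc (cutoff A f x) ^+ 2 <= normc (f x) ^+ 2.
Proof.
by rewrite /cutoff; case: ifP => // _; rewrite normc0 expr0n sqr_ge0.
Qed.

Lemma square_integrable_cutoff A f : measurable A -> square_integrable mu f ->
  square_integrable mu (cutoff A f).
Proof.
move=> mA f2; apply: le_square_integrable (f2); last exact: normc_cutoff.
by apply: measurable_cutoff => //; case: f2.
Qed.

(** The inner product of L^2, on functions instead of classes: most functions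
below are known before they are known to be square-integrable. *)
Definition cinner f g := complex_integral mu setT (fun x => f x * (g x)^*%C).

Lemma complex_integrable_inner f g :
  square_integrable mu f -> square_integrable mu g ->
  complex_integrable mu setT (fun x => f x * (g x)^*%C).
Proof.
move=> /square_integrableP[fR fI] /square_integrableP[gR gI]; split.
- apply: eq_integrable (integrableD measurableT
    (real_square_integrableM fR gR) (real_square_integrableM fI gI)) => //.
  by move=> x _ /=; rewrite Re_mulC EFinD.
- apply: eq_integrable (integrableB measurableT
    (real_square_integrableM fI gR) (real_square_integrableM fR gI)) => //.
  by move=> x _ /=; rewrite Im_mulC EFinB.
Qed.

Lemma complex_integralD f g : complex_integrable mu setT f ->
  complex_integrable mu setT g ->
  complex_integral mu setT (fun x => f x + g x) =
  complex_integral mu setT f + complex_integral mu setT g.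
Proof.
move=> [fR fI] [gR gI]; rewrite /complex_integral.
have -> : Rintegral mu setT (fun x => Re (f x + g x)) =
    Rintegral mu setT (fun x => Re (f x)) + Rintegral mu setT (fun x => Re (g x)).
  rewrite -RintegralD//; apply: eq_Rintegral => x _.
  by case: (f x) (g x) => a b [].
have -> // : Rintegral mu setT (fun x => Im (f x + g x)) =
    Rintegral mu setT (fun x => Im (f x)) + Rintegral mu setT (fun x => Im (g x)).
rewrite -RintegralD//; apply: eq_Rintegral => x _.
by case: (f x) (g x) => a b [].
Qed.

Lemma complex_integralB f g : complex_integrable mu setT f ->
  complex_integrable mu setT g ->
  complex_integral mu setT (fun x => f x - g x) =
  complex_integral mu setT f - complex_integral mu setT g.
Proof.
move=> [fR fI] [gR gI]; rewrite /complex_integral.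
have -> : Rintegral mu setT (fun x => Re (f x - g x)) =
    Rintegral mu setT (fun x => Re (f x)) - Rintegral mu setT (fun x => Re (g x)).
  rewrite -RintegralB//; apply: eq_Rintegral => x _.
  by case: (f x) (g x) => a b [].
have -> // : Rintegral mu setT (fun x => Im (f x - g x)) =
    Rintegral mu setT (fun x => Im (f x)) - Rintegral mu setT (fun x => Im (g x)).
rewrite -RintegralB//; apply: eq_Rintegral => x _.
by case: (f x) (g x) => a b [].
Qed.

Lemma ae_complex_integral f g : measurable_fun setT f -> measurable_fun setT g ->
  f = g %[ae mu] -> complex_integral mu setT f = complex_integral mu setT g.
Proof.
move=> mf mg fg; rewrite /complex_integral /Rintegral.
congr (Complex (fine _) (fine _)); apply: ae_eq_integral => //.
- by apply/measurable_EFinP; exact: measurable_Re.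
- by apply/measurable_EFinP; exact: measurable_Re.
- by apply: filterS fg => x /= /(_ I) -> _.
- by apply/measurable_EFinP; exact: measurable_Im.
- by apply/measurable_EFinP; exact: measurable_Im.
- by apply: filterS fg => x /= /(_ I) -> _.
Qed.

Lemma ae_complex_integrable f g : measurable_fun setT g -> f = g %[ae mu] ->
  complex_integrable mu setT f -> complex_integrable mu setT g.
Proof.
move=> mg fg [fR fI].
have key (u v : X -> R) : measurable_fun setT v -> u = v %[ae mu] ->
    mu.-integrable setT (fun x => (u x)%:E) -> mu.-integrable setT (fun x => (v x)%:E).
  move=> mv uv /integrableP[mu_ uoo].
  have mve : measurable_fun setT (fun x => (v x)%:E) by exact/measurable_EFinP.
  apply/integrableP; split => //.
  apply: le_lt_trans uoo; rewrite le_eqVlt; apply/orP; left; apply/eqP.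
  apply: ae_eq_integral => //.
  - exact: measurableT_comp.
  - exact: measurableT_comp.
  - by apply: filterS uv => x /= /(_ I) -> _.
split.
- by apply: key fR; [exact: measurable_Re|apply: filterS fg => x /= /(_ I) ->].
- by apply: key fI; [exact: measurable_Im|apply: filterS fg => x /= /(_ I) ->].
Qed.

End complex_functions.

(** * The Hilbert space structure of L2 *)

Section L2_theory.
Context d (X : measurableType d) (R : realType).
Variable mu : {measure set X -> \bar R}.
Implicit Types (f g : X -> R[i]) (F G H : L2 mu).

Lemma L2_exists f : square_integrable mu f ->
  exists F : L2 mu, (F : X -> R[i]) = f %[ae mu].
Proof.
move=> f2; have [mf _] := f2.
pose mf_pack : {mfun X >-> R[i]} := HB.pack_for {mfun X >-> R[i]} f
  (isMeasurableFun.Build _ _ _ _ f mf).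
pose c : {mfun_ mu, X >-> R[i]} := \pi_({mfun_ mu, X >-> R[i]})%qT mf_pack.
have cf : (c : X -> R[i]) = f %[ae mu].
  have /eqmodP/asboolP : repr c = mf_pack %[mod {mfun_ mu, X >-> R[i]}]%qT.
    by rewrite reprK.
  by [].
have c2 : square_integrable mu c.
  by apply: ae_square_integrable (ae_eq_sym cf) f2; exact: measurable_funPT.
by exists (MkL2 c2).
Qed.

Lemma L2_cinner F G : L2_inner mu F G = cinner mu F G. Proof. by []. Qed.

Lemma ae_cinner f f' g g' : measurable_fun setT f -> measurable_fun setT f' ->
  measurable_fun setT g -> measurable_fun setT g' ->
  f = f' %[ae mu] -> g = g' %[ae mu] -> cinner mu f g = cinner mu f' g'.
Proof.
move=> mf mf' mg mg' ff' gg'; apply: ae_complex_integral.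
- by apply: measurable_cM => //; exact: measurable_cconj.
- by apply: measurable_cM => //; exact: measurable_cconj.
- by apply: filterS2 ff' gg' => x /= + + _ => /(_ I) -> /(_ I) ->.
Qed.

Lemma cinnerBl f g h : square_integrable mu f -> square_integrable mu g ->
  square_integrable mu h ->
  cinner mu (fun x => f x - g x) h = cinner mu f h - cinner mu g h.
Proof.
move=> f2 g2 h2; rewrite /cinner -complex_integralB//;
  [|exact: complex_integrable_inner..].
by congr complex_integral; apply/funext => x; rewrite mulrBl.
Qed.

Lemma cinnerBr f g h : square_integrable mu f -> square_integrable mu g ->
  square_integrable mu h ->
  cinner mu f (fun x => g x - h x) = cinner mu f g - cinner mu f h.
Proof.
move=> f2 g2 h2; rewrite /cinner -complex_integralB//;
  [|exact: complex_integrable_inner..].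
by congr complex_integral; apply/funext => x; rewrite rmorphB mulrBr.
Qed.

Lemma cinnerDr f g h : square_integrable mu f -> square_integrable mu g ->
  square_integrable mu h ->
  cinner mu f (fun x => g x + h x) = cinner mu f g + cinner mu f h.
Proof.
move=> f2 g2 h2; rewrite /cinner -complex_integralD//;
  [|exact: complex_integrable_inner..].
by congr complex_integral; apply/funext => x; rewrite rmorphD mulrDr.
Qed.

Lemma cinner_eq0 f : square_integrable mu f -> cinner mu f f = 0 ->
  f = cst 0 %[ae mu].
Proof.
move=> f2 /(congr1 (fun z => Re z)) /= ff0; have [mf _] := f2.
have mn2 : measurable_fun setT (fun x => (normc (f x) ^+ 2)%:E).
  by apply: measurable_sqrE; exact: measurable_normc.
have /ae_eq_integral_abs : (\int[mu]_x `|(normc (f x) ^+ 2)%:E| = 0)%E.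
  under eq_integral do rewrite gee0_abs ?lee_fin ?sqr_ge0//.
  have : (\int[mu]_x (normc (f x) ^+ 2)%:E)%E \is a fin_num.
    rewrite ge0_fin_numE; first by case: f2.
    by apply: integral_ge0 => x _; rewrite lee_fin sqr_ge0.
  move=> /fineK <-; congr EFin; rewrite -[RHS]ff0 /Rintegral; congr fine.
  by apply: eq_integral => x _; rewrite normc_sqr Re_mulC -!expr2.
move=> /(_ measurableT mn2); apply: filterS => x /= + _ => /(_ I) [/eqP].
by rewrite sqrf_eq0 => /eqP/eq0_normc.
Qed.

Lemma Lnorm_normc_fin f : square_integrable mu f ->
  'N[mu]_2%:E[EFin \o (fun x => normc (f x))]%E \is a fin_num.
Proof.
by move=> f2; rewrite ge0_fin_numE ?Lnorm_ge0//; exact: square_integrable_Lnorm.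
Qed.

(** Cauchy-Schwarz, for the two components of the inner product separately. *)
Lemma cinner_le f g : square_integrable mu f -> square_integrable mu g ->
  let N h := fine 'N[mu]_2%:E[EFin \o (fun x => normc (h x))]%E in
  `|Re (cinner mu f g)| <= N f * N g /\ `|Im (cinner mu f g)| <= N f * N g.
Proof.
move=> f2 g2 N; have [iR iI] := complex_integrable_inner f2 g2.
have [mf _] := f2; have [mg _] := g2.
have mn : measurable_fun setT (fun x => normc (f x) * normc (g x)).
  by apply: measurable_funM; exact: measurable_normc.
have norm0 (z : R[i]) : 0 <= normc z by case: z => a b; exact: sqrtr_ge0.
have key (u : X -> R) : mu.-integrable setT (EFin \o u) ->
    (forall x, u x ^+ 2 <= normc (f x) ^+ 2 * normc (g x) ^+ 2) ->
    `|Rintegral mu setT u| <= N f * N g.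
  move=> iu ule; rewrite -lee_fin EFin_normr_Rintegral//.
  have mu_ : measurable_fun setT (EFin \o u) := measurable_int _ iu.
  apply: (le_trans (le_abse_integral mu measurableT mu_)).
    apply: (@le_trans _ _ ('N[mu]_1[EFin \o (fun x => (normc (f x) * normc (g x))%R)])%E).
    rewrite Lnorm1; apply: ge0_le_integral => //.
    - exact: measurableT_comp.
    - by apply: measurableT_comp => //; exact/measurable_EFinP.
    - move=> x _ /=; rewrite lee_fin -(@ler_pXn2r _ 2) ?nnegrE//.
      by rewrite !real_normK ?num_real// exprMn.
  rewrite EFinM !fineK ?Lnorm_normc_fin//.
  apply: hoelder => //; [exact: measurable_normc..|lra].
have nM x : normc (f x * (g x)^*%C) ^+ 2 = normc (f x) ^+ 2 * normc (g x) ^+ 2.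
  rewrite normc_sqrM; congr (_ * _); rewrite !normc_sqr.
  by case: (g x) => a b /=; rewrite sqrrN.
split; apply: key => //= x; rewrite -nM normc_sqr.
- by rewrite lerDl sqr_ge0.
- by rewrite lerDr sqr_ge0.
Qed.

Lemma L2_distE F G : mdist F G = fine
  'N[mu]_2%:E[EFin \o (fun x => normc (F x - G x)%R)]%E.
Proof. by []. Qed.

Let lip_continuous (a : L2 mu -> R) (c : R) :
  (forall F G, `|a F - a G| <= mdist F G * c) -> continuous a.
Proof.
move=> ac F; apply/(@cvgrPdist_lt _ _ _ (nbhs F)) => e e0.
have c0 : 0 < `|c| + 1 by rewrite ltr_pwDr.
near=> G; apply: le_lt_trans (ac _ _) _.
apply: (@le_lt_trans _ _ (mdist F G * (`|c| + 1))).
  rewrite ler_wpM2l ?mdist_ge0// (le_trans (ler_norm c))//.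
  by rewrite lerDl.
rewrite -ltr_pdivlMr//; near: G.
have := nbhsx_ballx F (e / (`|c| + 1)) (divr_gt0 e0 c0).
by rewrite ballEmdist.
Unshelve. all: by end_near. Qed.

Lemma L2_inner_continuousl G :
  continuous (fun F => Re (L2_inner mu F G)) /\
  continuous (fun F => Im (L2_inner mu F G)).
Proof.
have L2i F := L2_square_integrable F.
pose c := fine 'N[mu]_2%:E[EFin \o (fun x => normc (G x))]%E.
split; apply: (@lip_continuous _ c) => F F';
  have [] := cinner_le (square_integrableB (L2i F) (L2i F')) (L2i G);
  by rewrite cinnerBl//; case: (cinner mu F G) (cinner mu F' G) => a b [a' b'].
Qed.

Lemma L2_inner_continuousr F :
  continuous (fun G => Re (L2_inner mu F G)) /\
  continuous (fun G => Im (L2_inner mu F G)).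
Proof.
have L2i G := L2_square_integrable G.
pose c := fine 'N[mu]_2%:E[EFin \o (fun x => normc (F x))]%E.
split; apply: (@lip_continuous _ c) => G G';
  have [] := cinner_le (L2i F) (square_integrableB (L2i G) (L2i G'));
  rewrite mulrC cinnerBr//;
  by case: (cinner mu F G) (cinner mu F G') => a b [a' b'].
Qed.

Lemma L2_dist_lt F G e : 0 < e ->
  (mdist F G < e) = (\int[mu]_x (normc (F x - G x) ^+ 2)%:E < (e ^+ 2)%:E)%E.
Proof.
move=> e0; rewrite L2_distE Lnorm2E.
have FG2 : square_integrable mu (fun x => F x - G x).
  by apply: square_integrableB; exact: L2_square_integrable.
have Ifin : (\int[mu]_x (normc (F x - G x) ^+ 2)%:E)%E \is a fin_num.
  rewrite ge0_fin_numE; last by apply: integral_ge0 => x _; rewrite lee_fin sqr_ge0.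
  by case: FG2.
rewrite -(fineK Ifin) poweR_EFin/= powR12_sqrt; last first.
  by apply: fine_ge0; apply: integral_ge0 => x _; rewrite lee_fin sqr_ge0.
by rewrite -[X in _ < X](ger0_norm (ltW e0)) -sqrtr_sqr ltr_sqrt ?exprn_gt0.
Qed.

(** The square of the distance from [FA k] to [F] is the value at [~` A k] of the
finite measure |F|^2 mu, which tends to 0 by continuity from above. *)
Lemma cutoff_cvg (A : (set X)^nat) F (FA : nat -> L2 mu) :
  (forall k, measurable (A k)) -> nondecreasing_seq A -> \bigcup_k A k = setT ->
  (forall k, (FA k : X -> R[i]) = cutoff (A k) F %[ae mu]) ->
  FA k @[k --> \oo] --> F.
Proof.
move=> mA ndA TA FAE; apply/cvg_ballP => e e0.
have F2 := L2_square_integrable F; have [mF iF] := F2.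
have mFA k : measurable_fun setT (cutoff (A k) F) by exact: measurable_cutoff.
have distE k : (\int[mu]_x (normc (F x - FA k x) ^+ 2)%:E =
    \int[mu]_(x in ~` A k) (normc (F x) ^+ 2)%:E)%E.
  rewrite [RHS]integral_mkcond; apply: ge0_ae_eq_integral => //.
  - by apply: measurable_sqrE; apply: measurable_normc;
      apply: measurable_cB => //; exact: L2_measurable.
  - apply/(measurable_restrictT _ _).1; first exact: measurableC.
    by apply: measurable_funTS; apply: measurable_sqrE; exact: measurable_normc.
  - by move=> x _; rewrite lee_fin sqr_ge0.
  - by move=> x _; apply: erestrict_ge0 => {}x _; rewrite lee_fin sqr_ge0.
  - apply: filterS (FAE k) => x /= /(_ I) -> _; rewrite /cutoff /patch in_setC.
    by case: (x \in A k); rewrite /= ?subrr ?normc0 ?expr0n ?subr0.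
have mF2 : measurable_fun setT (fun x => normc (F x) ^+ 2).
  by apply: measurable_funX; exact: measurable_normc.
have [n nE] := density_measure_exists mu mF2 (fun x => sqr_ge0 _).
have cvn : n (~` A k) @[k --> \oo] --> 0%E.
  have <- : n (\bigcap_k ~` A k) = 0%E.
    by rewrite -setC_bigcup TA setCT measure0.
  apply: nonincreasing_cvg_mu.
  - rewrite nE (le_lt_trans _ iF)//; apply: ge0_subset_integral => //.
    + exact: measurableC.
    + exact: measurable_sqrE (measurable_normc mF).
    + by move=> x _; rewrite lee_fin sqr_ge0.
  - by move=> k; exact: measurableC.
  - by apply: bigcapT_measurable => k; exact: measurableC.
  - by move=> i j ij; apply/subsetPset; apply: subsetC; apply/subsetPset; exact: ndA.
have e20 : (0 < (e ^+ 2)%:E)%E by rewrite lte_fin exprn_gt0.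
have ev : \forall k \near \oo, (n (~` A k) < (e ^+ 2)%:E)%E.
  exact: cvn _ (open_ereal_lt' e20).
apply: filterS ev => k nAk.
have Fke : mdist F (FA k) < e by rewrite L2_dist_lt// distE -nE.
by rewrite ballEmdist.
Qed.

Lemma closed_complex_eq (T : topologicalType) (a b : T -> R[i]) :
  continuous (fun t => Re (a t)) -> continuous (fun t => Im (a t)) ->
  continuous (fun t => Re (b t)) -> continuous (fun t => Im (b t)) ->
  closed [set t | a t = b t].
Proof.
move=> Rea Ima Reb Imb.
rewrite (_ : [set t | _] = (fun t => Re (a t) - Re (b t)) @^-1` [set 0] `&`
    (fun t => Im (a t) - Im (b t)) @^-1` [set 0]).
  apply: closedI; (apply: preimage_closed; last exact: closed_eq) => t _.
  - exact: (continuousB (Rea t) (Reb t)).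
  - exact: (continuousB (Ima t) (Imb t)).
apply/seteqP; split => t /=; first by move=> ->; rewrite !subrr.
move=> [/subr0_eq + /subr0_eq].
by case: (a t) (b t) => x y [x' y'] /= -> ->.
Qed.

(** The graph of an adjoint, and the set of pairs that an adjoint pairs
correctly with a given element of its graph, are intersections of closed sets
of this form. *)
Lemma closed_adjoint_pair G K : closed
  [set p : L2 mu * L2 mu | L2_inner mu p.2 G = L2_inner mu p.1 K].
Proof.
have [RG IG] := L2_inner_continuousl G; have [RK IK] := L2_inner_continuousl K.
apply: closed_complex_eq => p.
- exact: (continuous_comp cvg_snd (RG _)).
- exact: (continuous_comp cvg_snd (IG _)).
- exact: (continuous_comp cvg_fst (RK _)).
- exact: (continuous_comp cvg_fst (IK _)).
Qed.

Lemma closed_adjoint_pair2 F F1 F2 : closed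
  [set q : (L2 mu * L2 mu) * L2 mu |
    L2_inner2 mu (F1, F2) q.1 = L2_inner mu F q.2].
Proof.
have [RF IF] := L2_inner_continuousr F.
have [R1 I1] := L2_inner_continuousr F1; have [R2 I2] := L2_inner_continuousr F2.
have c1 : continuous (fun q : (L2 mu * L2 mu) * L2 mu => q.1.1).
  by move=> q; exact: (continuous_comp cvg_fst cvg_fst).
have c2 : continuous (fun q : (L2 mu * L2 mu) * L2 mu => q.1.2).
  by move=> q; exact: (continuous_comp cvg_fst cvg_snd).
apply: closed_complex_eq => q.
- rewrite (_ : (fun t => _) = (fun t : (L2 mu * L2 mu) * L2 mu =>
    Re (L2_inner mu F1 t.1.1) + Re (L2_inner mu F2 t.1.2))).
    exact: (continuousD (continuous_comp (c1 q) (R1 _))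
      (continuous_comp (c2 q) (R2 _))).
  apply/funext => t; rewrite /L2_inner2 /=.
  by case: (L2_inner mu F1 t.1.1) (L2_inner mu F2 t.1.2) => a b [].
- rewrite (_ : (fun t => _) = (fun t : (L2 mu * L2 mu) * L2 mu =>
    Im (L2_inner mu F1 t.1.1) + Im (L2_inner mu F2 t.1.2))).
    exact: (continuousD (continuous_comp (c1 q) (I1 _))
      (continuous_comp (c2 q) (I2 _))).
  apply/funext => t; rewrite /L2_inner2 /=.
  by case: (L2_inner mu F1 t.1.1) (L2_inner mu F2 t.1.2) => a b [].
- exact: (continuous_comp cvg_snd (RF _)).
- exact: (continuous_comp cvg_snd (IF _)).
Qed.

End L2_theory.

(** * A single weighted composition operator *)

Section weighted_composition_operator.
Context d (X : measurableType d) (R : realType).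
Variables (mu : {sigma_finite_measure set X -> \bar R}).
Variables (phi : {mfun X >-> X}) (om : {mfun X >-> R[i]}).
Let m : {measure set X -> \bar R} := weighted_measure mu om.
Let w x := normc (om x) ^+ 2.

Let mphi : measurable_fun setT phi. Proof. exact: measurable_funPT. Qed.
Let mw : measurable_fun setT w.
Proof. by apply: measurable_funX; exact: measurable_normc. Qed.
Let w0 x : 0 <= w x. Proof. exact: sqr_ge0. Qed.
Let mE A : measurable A -> m A = (\int[mu]_(x in A) (w x)%:E)%E.
Proof. by []. Qed.
Let mphiI A : measurable A -> measurable (phi @^-1` A).
Proof. by move=> mA; rewrite -[X in measurable X]setTI; exact: mphi. Qed.

(* nu is the measure h dmu, but exists before h does. *)
Variable nu : {measure set X -> \bar R}.
Hypothesis nuE : forall A, nu A = m (phi @^-1` A).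

Let nuE' A : measurable A -> nu A = m (phi @^-1` A). Proof. by []. Qed.

Lemma wcomp_integral (f : X -> R[i]) : measurable_fun setT f ->
  (\int[mu]_x (normc (om x * f (phi x)) ^+ 2)%:E =
   \int[nu]_x (normc (f x) ^+ 2)%:E)%E.
Proof.
move=> mf; have mf2 := measurable_sqrE (measurable_normc mf).
have f20 x : (0 <= (normc (f x) ^+ 2)%:E)%E by rewrite lee_fin sqr_ge0.
rewrite (ge0_integral_image nuE' mf2)//.
rewrite (ge0_integral_density mw w0 mE (f := fun x => (normc (f (phi x)) ^+ 2)%:E))//.
  by apply: eq_integral => x _; rewrite normc_sqrM -EFinM mulrC.
exact: (measurableT_comp mf2).
Qed.

Lemma wcomp_square_integrable (f : X -> R[i]) : measurable_fun setT f ->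
  square_integrable mu (fun x => om x * f (phi x)) <-> square_integrable nu f.
Proof.
move=> mf; rewrite /square_integrable wcomp_integral//; split=> -[_ ?] //.
by split => //; apply: measurable_cM => //; exact: (measurableT_comp mf).
Qed.

Lemma wcomp_domainE (F : L2 mu) :
  wcomp_domain mu phi om F <-> square_integrable nu F.
Proof. by apply: wcomp_square_integrable; exact: L2_measurable. Qed.

Hypothesis wd : wcomp_well_defined mu phi om.

Lemma image_weighted_dominated : nu `<< mu.
Proof.
apply: (subset_trans wd) => A; rewrite /null_set /= => NA B /NA{}NA /NA.
by rewrite nuE.
Qed.

(** Let f_k be a function of the domain at distance less than 1/(k+1) from the
indicator of F_k, where the F_k increase to X and have finite [mu]-measure.  By
Chebyshev's inequality S_k = {|f_k| >= 1/2} has finite [nu]-measure.  The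
complement N of the union of the S_k is [mu]-null: on N /\ F_j the indicator of
F_k is at distance at least 1/2 from f_k for all k >= j, so that
mu(N /\ F_j) <= 4/(k+1)^2.  By absolute continuity, N is [nu]-null. *)
Lemma dense_domain_sigma_finite :
  closure (op_domain (wcomp mu phi om)) = setT -> sigma_finite setT nu.
Proof.
move=> dom_dense.
have /sigma_finiteP[F [TF ndF /all_and2[mF muF']]] := sigma_finiteT mu.
have muF k : (mu (F k) < +oo)%E := muF' k.
have one2 k : square_integrable mu (cutoff (F k) (cst 1)).
  split; first by apply: measurable_cutoff => //; exact: measurable_cst.
  rewrite (_ : (\int[mu]_x _)%E = mu (F k))//.
  rewrite -[RHS]mul1e -integral_cst// integral_mkcond; apply: eq_integral => x _.
  rewrite /cutoff /patch; case: ifP => _; rewrite ?normc0 ?expr0n//.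
  by rewrite /= expr0n addr0 expr1n sqrtr1 expr1n.
have [e eE] := choice (fun k => L2_exists (one2 k)).
have approx k : exists f : L2 mu, wcomp_domain mu phi om f /\
    (\int[mu]_x (normc (e k x - f x)%R ^+ 2)%:E < ((k.+1%:R^-1) ^+ 2)%:E)%E.
  have k0 : 0 < k.+1%:R^-1 :> R by rewrite invr_gt0.
  have : closure (op_domain (wcomp mu phi om)) (e k) by rewrite dom_dense.
  move=> /(_ _ (nbhsx_ballx (e k) _ k0)) [f [[v /= [fd _]]]].
  rewrite ballEmdist /= => ef; exists f; split => //.
  by rewrite -L2_dist_lt.
have {approx}[f /all_and2[fdom fapprox]] := choice approx.
pose S k := [set x | 1/2 <= normc (f k x)].
have mf k : measurable_fun setT (f k) by exact: L2_measurable.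
have mS k : measurable (S k).
  rewrite -[X in measurable X]setTI; apply: measurable_fun_le => //.
  exact: measurable_normc.
have nuS k : (nu (S k) < +oo)%E.
  have [_ fk2] : square_integrable nu (f k) by apply/wcomp_domainE.
  have : (\int[nu]_(x in S k) cst (1/4)%:E x <=
      \int[nu]_x (normc (f k x) ^+ 2)%:E)%E.
    have mf2 := measurable_sqrE (measurable_normc (mf k)).
    apply: (@le_trans _ _ (\int[nu]_(x in S k) (normc (f k x) ^+ 2)%:E)%E).
      apply: ge0_le_integral => //.
      - by move=> x _; rewrite lee_fin; lra.
      - exact: measurable_funTS.
      - by move=> x /= Skx; rewrite lee_fin; have : 1/2 <= normc (f k x) by []; nra.
    apply: ge0_subset_integral => //.
    by move=> x _; rewrite lee_fin sqr_ge0.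
  rewrite integral_cst// => le4.
  have := le_lt_trans le4 fk2.
  case: (nu (S k)) => [r _| |_] //=; first exact: ltry.
  by rewrite gt0_muley// lte_fin; lra.
pose N := ~` \bigcup_k S k.
have mN : measurable N by apply: measurableC; exact: bigcupT_measurable.
have muN : mu N = 0%E.
  suff NF j : mu (N `&` F j) = 0%E.
    rewrite -[N]setIT TF setI_bigcupr.
    apply/negligibleP; first by apply: bigcupT_measurable => j; exact: measurableI.
    apply: negligible_bigcup => j.
    by apply/negligibleP; [exact: measurableI|exact: NF].
  have mNF : measurable (N `&` F j) by exact: measurableI.
  have le4 k : (j <= k)%N -> ((1/4)%:E * mu (N `&` F j) <= ((k.+1%:R^-1) ^+ 2)%:E)%E.
    move=> jk; apply: le_trans (ltW (fapprox k)).
    rewrite -integral_cst//.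
    have mef : measurable_fun setT (fun x => (normc (e k x - f k x) ^+ 2)%:E).
      by apply: measurable_sqrE; apply: measurable_normcB => //; exact: L2_measurable.
    apply: (@le_trans _ _ (\int[mu]_(x in N `&` F j)
        (normc (e k x - f k x)%R ^+ 2)%:E)%E).
      apply: ae_ge0_le_integral => //.
      - by move=> x _; rewrite lee_fin; lra.
      - by move=> x _; rewrite lee_fin sqr_ge0.
      - exact: measurable_funTS.
      - apply: filterS (eE k) => x /= /(_ I) -> [Nx Fx].
        have {}Fx : F k x by have /subsetPset := ndF _ _ jk; exact.
        rewrite /cutoff mem_set//= lee_fin.
        have fx : normc (f k x) < 1/2.
          by rewrite ltNge; apply/negP => ?; apply: Nx; exists k.
        have := le_normcD (1 - f k x) (f k x); rewrite subrK.
        have -> : normc (1 : R[i]) = 1 by rewrite /= expr0n addr0 expr1n sqrtr1.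
        nra.
    apply: ge0_subset_integral => //.
    by move=> x _; rewrite lee_fin sqr_ge0.
  apply/eqP; rewrite -measure_le0 leNgt; apply/negP => pos.
  have : (0 < (1/4)%:E * mu (N `&` F j))%E by rewrite mule_gt0// lte_fin; lra.
  set c := (_ * _)%E in le4 *; move=> c0.
  have cfin : c \is a fin_num.
    rewrite ge0_fin_numE ?ltW//.
    by rewrite (le_lt_trans (le4 j (leqnn j)))// ltry.
  have c0' : 0 < fine c by rewrite fine_gt0// c0 -ge0_fin_numE// ltW.
  pose k := maxn j (Num.truncn (fine c)^-1).
  have := le4 k (leq_maxl _ _); apply/negP; rewrite -ltNge -(fineK cfin) lte_fin.
  have k1 : (fine c)^-1 < k.+1%:R.
    by rewrite (lt_le_trans (truncnS_gt _))// ler_nat ltnS leq_maxr.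
  have ck : k.+1%:R^-1 < fine c by rewrite invf_plt ?posrE.
  apply: le_lt_trans ck; rewrite expr2 ler_piMr ?invr_ge0//.
  by rewrite invf_le1// ler1n.
have nuN : nu N = 0%E.
  by move/null_content_dominatesP : image_weighted_dominated; exact.
exists (fun k => N `|` S k).
  apply/esym; rewrite -subTset => x _; have [[k _ Skx]|Nx] := pselect ((\bigcup_k S k) x).
    by exists k => //; right.
  by exists 0%N => //; left.
move=> k; split; first exact: measurableU.
have NS : (nu (N `|` S k) <= nu N + nu (S k))%E by exact: measureU2.
by apply: le_lt_trans NS _; rewrite nuN add0e.
Qed.

Hypothesis nu_sfin : sigma_finite setT nu.

Lemma wcomp_RNP : is_wcomp_RN mu phi om (wcomp_RN mu phi om).
Proof.
have [h [mh h0 hE]] := sigma_finite_radon_nikodym nu_sfin image_weighted_dominated.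
apply: (@xgetPex _ (cst 0%E) [set h | is_wcomp_RN mu phi om h]).
exists (EFin \o h); split => [|x|A mA].
- exact/measurable_EFinP.
- by rewrite lee_fin.
- by rewrite -hE// nuE.
Qed.

(** A real-valued version of the density h; it agrees with h a.e., because [nu]
is sigma-finite. *)
Definition fine_RN x : R := fine (wcomp_RN mu phi om x).

Lemma measurable_fine_RN : measurable_fun setT fine_RN.
Proof.
by have [mh _ _] := wcomp_RNP; apply: measurableT_comp => //; exact: measurable_fine.
Qed.

Lemma fine_RN_ge0 x : 0 <= fine_RN x.
Proof. by have [_ h0 _] := wcomp_RNP; apply: fine_ge0. Qed.

Lemma ae_fine_RN : {ae mu, forall x, wcomp_RN mu phi om x = (fine_RN x)%:E}.
Proof.
have [mh h0 hE] := wcomp_RNP.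
have [F TF /all_and2[mF nuF]] := nu_sfin.
have fin k : {ae mu, forall x, F k x -> wcomp_RN mu phi om x \is a fin_num}.
  apply: integrable_ae => //; apply/integrableP; split.
    exact: measurable_funTS.
  under eq_integral do rewrite gee0_abs//.
  by rewrite -hE// -nuE' ?nuF.
have /ae_foralln := fin; apply: filterS => x finx.
have [k _ Fkx] : (\bigcup_k F k) x by rewrite -TF.
by rewrite /fine_RN fineK//; exact: finx Fkx.
Qed.

Lemma image_weightedE A : measurable A ->
  nu A = (\int[mu]_(x in A) (fine_RN x)%:E)%E.
Proof.
move=> mA; have [mh h0 hE] := wcomp_RNP.
rewrite nuE [LHS]hE//; apply: ae_eq_integral => //.
- exact: measurable_funTS.
- by apply: measurable_funTS; apply/measurable_EFinP; exact: measurable_fine_RN.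
- by apply: filterS ae_fine_RN => x /= ->.
Qed.

Lemma complex_integral_weighted (k : X -> R[i]) : measurable_fun setT k ->
  complex_integral m setT k =
  complex_integral mu setT (fun x => k x * (w x)%:C%C).
Proof.
move=> mk; rewrite /complex_integral /Rintegral.
rewrite (integral_density mw w0 mE (measurable_Re mk)).
rewrite (integral_density mw w0 mE (measurable_Im mk)).
by congr (Complex (fine _) (fine _)); apply: eq_integral => x _;
  case: (k x) => a b /=; rewrite ?mulr0 ?subr0 ?addr0 ?add0r.
Qed.

Lemma complex_integral_image_weighted (k : X -> R[i]) : measurable_fun setT k ->
  complex_integral nu setT k =
  complex_integral mu setT (fun x => k x * (fine_RN x)%:C%C).
Proof.
move=> mk; rewrite /complex_integral /Rintegral.
have dens := integral_density measurable_fine_RN fine_RN_ge0 image_weightedE.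
rewrite (dens _ (measurable_Re mk)) (dens _ (measurable_Im mk)).
by congr (Complex (fine _) (fine _)); apply: eq_integral => x _;
  case: (k x) => a b /=; rewrite ?mulr0 ?subr0 ?addr0 ?add0r.
Qed.

(** A form without case distinction, from which measurability can be read off:
at the zeros of [om] the inverse of [w] is 0. *)
Lemma wcomp_quotientE f x :
  wcomp_quotient om f x = f x * ((om x)^*%C * ((w x)^-1)%:C%C).
Proof.
rewrite /wcomp_quotient; have [->|omx] := eqVneq (om x) 0.
  by rewrite conjc0 mul0r mulr0.
congr (_ * _); apply: (mulfI omx); rewrite mulfV// mulrA mulcJ -/(w x).
have wx : w x != 0.
  by rewrite sqrf_eq0; apply: contraNneq omx => /eq0_normc ->.
by rewrite -rmorphM mulfV.
Qed.

Lemma square_integrable_quotient f : square_integrable mu f ->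
  square_integrable m (wcomp_quotient om f).
Proof.
move=> [mf f2]; have mq : measurable_fun setT (wcomp_quotient om f).
  rewrite (_ : wcomp_quotient om f =
      (fun x => f x * ((om x)^*%C * ((w x)^-1)%:C%C))).
    apply: measurable_cM => //; apply: measurable_cM.
      exact: measurable_cconj.
    apply: measurable_real_complex.
    rewrite (_ : (fun x => _) = (fun x => (w x) `^ (-1))).
      exact: (measurableT_comp (measurable_powR _)).
    by apply/funext => x; rewrite powR_inv1.
  by apply/funext => x; rewrite wcomp_quotientE.
split => //; have mq2 := measurable_sqrE (measurable_normc mq).
rewrite (ge0_integral_density mw w0 mE mq2).
  apply: le_lt_trans f2; apply: ge0_le_integral => //.
  - by move=> x _; rewrite mule_ge0// lee_fin// sqr_ge0.
  - by apply: emeasurable_funM => //; exact/measurable_EFinP.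
  - exact: measurable_sqrE (measurable_normc mf).
  - move=> x _; rewrite -EFinM lee_fin -normc_sqrM /wcomp_quotient.
    have [->|omx] := eqVneq (om x) 0; last by rewrite divfK.
    by rewrite mulr0 normc0 expr0n sqr_ge0.
by move=> x; rewrite lee_fin sqr_ge0.
Qed.

Definition equal_fiber_integrals (u1 u2 : X -> R) := forall A, measurable A ->
  (m (phi @^-1` A) < +oo)%E ->
  [/\ m.-integrable (phi @^-1` A) (EFin \o u1),
      m.-integrable (phi @^-1` A) (EFin \o u2) &
      Rintegral m (phi @^-1` A) u1 = Rintegral m (phi @^-1` A) u2].

(** The set where u1 > u2 has the form phi^-1(B), since both functions are
measurable for the sigma-algebra of [phi].  On its parts of finite measure
u1 - u2 is positive with integral 0, so these parts are null. *)
Lemma condexp_le (u1 u2 : X -> R) :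
  measurable_fun [set: g_sigma_algebra_preimageType phi] u1 ->
  measurable_fun [set: g_sigma_algebra_preimageType phi] u2 ->
  equal_fiber_integrals u1 u2 -> {ae m, forall x, u1 x <= u2 x}.
Proof.
move=> mu1 mu2 u12.
have [B mB BE] : exists2 B, measurable B &
    phi @^-1` B = [set x | 0 < u1 x - u2 x].
  have := measurable_funB mu1 mu2 measurableT (measurable_itv `]0, +oo[).
  move=> [B mB BE]; exists B => //; rewrite -[LHS]setTI BE setTI.
  by apply/seteqP; split => x /=; rewrite in_itv/= andbT.
have [F TF /all_and2[mF nuF]] := nu_sfin.
suff BF k : m (phi @^-1` (B `&` F k)) = 0%E.
  exists (phi @^-1` B); split; first exact: mphiI.
    apply/negligibleP; first exact: mphiI.
    rewrite -[B]setIT TF setI_bigcupr preimage_bigcup.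
    apply: negligible_bigcup => k; apply/negligibleP; last exact: BF.
    by apply: mphiI; exact: measurableI.
  by rewrite BE => x /negP; rewrite -ltNge /= subr_gt0.
have mBF : measurable (B `&` F k) by exact: measurableI.
have mpBF := mphiI mBF.
have fin : (m (phi @^-1` (B `&` F k)) < +oo)%E.
  rewrite -nuE'//; apply: le_lt_trans (nuF k).
  by apply: le_measure; rewrite ?inE//; exact: subIsetr.
have [i1 i2 I12] := u12 _ mBF fin.
pose D x := u1 x - u2 x.
have mD : measurable_fun (phi @^-1` (B `&` F k)) (EFin \o D).
  by apply/measurable_EFinP; apply: measurable_funB; apply/measurable_EFinP;
    [exact: measurable_int i1|exact: measurable_int i2].
have D0 x : (phi @^-1` (B `&` F k)) x -> 0 < D x.
  by move=> [Bx _]; have : (phi @^-1` B) x by []; rewrite BE.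
have : (\int[m]_(x in phi @^-1` (B `&` F k)) `|(EFin \o D) x| = 0)%E.
  rewrite (eq_integral (fun x => (u1 x)%:E - (u2 x)%:E)%E).
    rewrite integralB_EFin//; move: I12; rewrite /Rintegral.
    rewrite -{2}(fineK (integrable_fin_num mpBF i1)).
    rewrite -{2}(fineK (integrable_fin_num mpBF i2)) => ->.
    by rewrite subee.
  by move=> x; rewrite inE => /D0 Dx; rewrite gee0_abs ?lee_fin ?ltW// EFinB.
move=> /(ae_eq_integral_abs _ mpBF mD) D0ae.
apply/negligibleP => //; apply: negligibleS D0ae => x BFx /= /(_ BFx) [D0'].
by have := D0 x BFx; rewrite D0' ltxx.
Qed.

(** [G \o phi] is the projection of [q] on the functions of [phi]; real test
functions suffice to express it. *)
Definition is_projection (q G : X -> R[i]) :=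
  forall g, real_square_integrable nu g ->
  (\int[m]_x (g (phi x) * Re (q x))%:E = \int[nu]_y (g y * Re (G y))%:E)%E /\
  (\int[m]_x (g (phi x) * Im (q x))%:E = \int[nu]_y (g y * Im (G y))%:E)%E.

Lemma complex_projection (q : X -> R[i]) : square_integrable m q ->
  exists2 G : X -> R[i], square_integrable nu G & is_projection q G.
Proof.
move=> /square_integrableP[qR qI].
have [G1 G12 G1E] := projection nuE' nu_sfin qR.
have [G2 G22 G2E] := projection nuE' nu_sfin qI.
exists (fun y => Complex (G1 y) (G2 y)); first exact/square_integrableP.
by move=> g g2 /=; rewrite G1E// G2E.
Qed.

(** The indicators of the sets of finite [nu]-measure are admissible test
functions. *)
Lemma condexp_projection (q G : X -> R[i]) : square_integrable nu G ->
  is_projection q G -> is_wcomp_condexp mu phi om q (G \o phi).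
Proof.
move=> G2 qG; have [mG _] := G2; split.
  move=> _ B mB; rewrite setTI; exists (G @^-1` B); last by rewrite setTI.
  by rewrite -[X in measurable X]setTI; exact: mG.
move=> A mA mAoo.
have indic2 : real_square_integrable nu \1_A.
  split; first exact: measurable_indic.
  rewrite (_ : (\int[nu]_x _)%E = nu A); first by rewrite nuE.
  rewrite -[A in RHS]setIT -(integral_indic nu measurableT mA).
  by apply: eq_integral => x _; rewrite indicE; case: (x \in A); rewrite ?expr1n ?expr0n.
have mkcond (u : X -> R) x : ((EFin \o u) \_ (phi @^-1` A)) x =
    (\1_A (phi x) * u x)%:E.
  rewrite /patch indicE (_ : (x \in phi @^-1` A) = (phi x \in A)); last first.
    by apply/idP/idP; rewrite !inE.
  by case: (phi x \in A); rewrite ?mul1r ?mul0r.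
have intA (u : X -> R) : real_square_integrable nu u ->
    m.-integrable (phi @^-1` A) (EFin \o (u \o phi)).
  move=> u2; apply/(integrable_mkcond _ (mphiI mA)).
  apply: eq_integrable (real_square_integrableM
    (real_square_integrable_image nuE' indic2)
    (real_square_integrable_image nuE' u2)) => //.
have eqA (r u : X -> R) : measurable_fun setT u ->
    (\int[m]_x (\1_A (phi x) * r x)%:E = \int[nu]_y (\1_A y * u y)%:E)%E ->
    Rintegral m (phi @^-1` A) r = Rintegral m (phi @^-1` A) (u \o phi).
  move=> mu_ ru; rewrite /Rintegral integral_mkcond [in RHS]integral_mkcond.
  under eq_integral do rewrite mkcond.
  under [in RHS]eq_integral do rewrite mkcond.
  rewrite ru (integral_image nuE')//.
  by apply: measurable_funM => //; exact: measurable_indic.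
have /square_integrableP[GR GI] := G2; have [qR qI] := qG _ indic2.
split; first by split; [exact: (intA _ GR)|exact: (intA _ GI)].
by congr Complex; [exact: (eqA _ _ GR.1 qR)|exact: (eqA _ _ GI.1 qI)].
Qed.

Lemma condexp_unique (q E1 E2 : X -> R[i]) :
  is_wcomp_condexp mu phi om q E1 -> is_wcomp_condexp mu phi om q E2 ->
  {ae m, forall x, E1 x = E2 x}.
Proof.
move=> [mE1 qE1] [mE2 qE2].
have [mR1 mI1] := (measurable_Re mE1, measurable_Im mE1).
have [mR2 mI2] := (measurable_Re mE2, measurable_Im mE2).
have like : [/\ equal_fiber_integrals (fun x => Re (E1 x)) (fun x => Re (E2 x)),
    equal_fiber_integrals (fun x => Re (E2 x)) (fun x => Re (E1 x)),
    equal_fiber_integrals (fun x => Im (E1 x)) (fun x => Im (E2 x)) &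
    equal_fiber_integrals (fun x => Im (E2 x)) (fun x => Im (E1 x))].
  by split => A mA Aoo; have [[? ?] [e1 e2]] := qE1 _ mA Aoo;
    have [[? ?] [e1' e2']] := qE2 _ mA Aoo; split => //;
    rewrite -?e1 -?e1' -?e2 -?e2'.
have [R12 R21 I12 I21] := like.
have R12' := condexp_le mR1 mR2 R12; have R21' := condexp_le mR2 mR1 R21.
have I12' := condexp_le mI1 mI2 I12; have I21' := condexp_le mI2 mI1 I21.
have Re12 : {ae m, forall x, Re (E1 x) = Re (E2 x)}.
  by apply: filterS2 R12' R21' => x ? ?; apply/eqP; rewrite eq_le; apply/andP.
have Im12 : {ae m, forall x, Im (E1 x) = Im (E2 x)}.
  by apply: filterS2 I12' I21' => x ? ?; apply/eqP; rewrite eq_le; apply/andP.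
apply: filterS2 Re12 Im12 => x.
by case: (E1 x) (E2 x) => a b [a' b'] /= -> ->.
Qed.

(** The conditional expectation and its pull-back are only determined up to
null sets.  With [G] the projection of f_om, [G \o phi] is a conditional
expectation, hence equals the chosen one a.e.; the chosen pull-back then agrees
with [G] [nu]-a.e., which after multiplication by the density of [nu] becomes
equality [mu]-a.e. *)
Lemma wcomp_adjoint_funP (f : X -> R[i]) : square_integrable mu f ->
  measurable_fun setT (wcomp_adjoint_fun mu phi om f) /\
  exists G : X -> R[i], [/\ square_integrable nu G,
    {ae mu, forall x, wcomp_adjoint_fun mu phi om f x = (fine_RN x)%:C%C * G x} &
    forall g, square_integrable nu g ->
      complex_integral m setT (fun x => g (phi x) * (wcomp_quotient om f x)^*%C) =
      cinner nu g G].
Proof.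
move=> f2; have q2 := square_integrable_quotient f2.
have [mq _] := q2.
set q := wcomp_quotient om f in q2 mq *.
have [G G2 GE] := complex_projection q2; have [mG _] := G2.
have condG := condexp_projection G2 GE.
have condE : is_wcomp_condexp mu phi om q (wcomp_condexp mu phi om q).
  apply: (@xgetPex _ (cst 0) [set E | is_wcomp_condexp mu phi om q E]).
  by exists (G \o phi).
have EG := condexp_unique condE condG.
have [mh h0 hE] := wcomp_RNP.
have pullP : is_wcomp_pullback mu phi om (wcomp_condexp mu phi om q)
    (wcomp_pullback mu phi om (wcomp_condexp mu phi om q)).
  apply: (@xgetPex _ (cst 0) [set g | is_wcomp_pullback mu phi om _ g]).
  pose Z := [set x | wcomp_RN mu phi om x = 0%E].
  have mZ : measurable Z.
    rewrite -[X in measurable X]setTI; exact: mh _ (emeasurable_set1 _).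
  (* A pull-back is G, made zero where h is; phi avoids Z a.e. *)
  exists (cutoff (~` Z) G); split.
  - by apply: measurable_cutoff => //; exact: measurableC.
  - by apply: aeW => x Zx; rewrite /cutoff memNset//= => /(_ Zx).
  - have Z0 : {ae m, forall x, ~ Z (phi x)}.
      exists (phi @^-1` Z); split; first exact: mphiI.
        by rewrite [LHS]hE// integral0_eq.
      by move=> x /= /contrapT.
    by apply: filterS2 Z0 EG => x Zx ->; rewrite /cutoff mem_set.
move: pullP; set g := wcomp_pullback _ _ _ _ => -[mg g0 gE].
split.
  apply: measurable_cM => //; apply: measurable_real_complex.
  exact: measurable_fine_RN.
exists G; split => //.
- pose N := [set x | 0 < normc (g x - G x)].
  have mN : measurable N.
    have := measurable_normcB mg mG measurableT (measurable_itv `]0, +oo[).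
    rewrite setTI; congr measurable; apply/seteqP.
    by split => x /=; rewrite in_itv/= andbT.
  have mN0 : m (phi @^-1` N) = 0%E.
    apply/negligibleP; first exact: mphiI.
    apply: negligibleS (filterI gE EG) => x Nx /= [gx Ex].
    by move: Nx; rewrite /N /= gx Ex /= subrr normc0 ltxx.
  have hN : (\int[mu]_(x in N) `|wcomp_RN mu phi om x| = 0)%E.
    by under eq_integral do rewrite gee0_abs//; rewrite -[LHS]hE.
  have mhN : measurable_fun N (wcomp_RN mu phi om) by exact: measurable_funTS.
  have {}hN := (ae_eq_integral_abs _ mN mhN).1 hN.
  apply: filterS hN => x /= hx; rewrite /wcomp_adjoint_fun -/q -/g -/(fine_RN x).
  have [->//|gG] := eqVneq (g x) (G x).
  rewrite /fine_RN hx /= ?mul0r// /N /=.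
  rewrite lt_neqAle eq_sym; apply/andP; split.
    by apply: contraNneq gG => /eq0_normc/eqP; rewrite subr_eq0.
  by case: (g x - G x) => a b; exact: sqrtr_ge0.
- move=> k k2; have /square_integrableP[kR kI] := k2.
  have /square_integrableP[GR GI] := G2; have /square_integrableP[qR qI] := q2.
  have [RR RI] := GE _ kR; have [IR II] := GE _ kI.
  have kRphi := real_square_integrable_image nuE' kR.
  have kIphi := real_square_integrable_image nuE' kI.
  rewrite /cinner /complex_integral /Rintegral; congr (Complex (fine _) (fine _)).
  - under eq_integral do rewrite Re_mulC EFinD.
    under [RHS]eq_integral do rewrite Re_mulC EFinD.
    rewrite integralD//; [|exact: real_square_integrableM kRphi qR|
      exact: real_square_integrableM kIphi qI].
    rewrite [RHS]integralD//; [|exact: real_square_integrableM kR GR|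
      exact: real_square_integrableM kI GI].
    by rewrite RR II.
  - under eq_integral do rewrite Im_mulC EFinB.
    under [RHS]eq_integral do rewrite Im_mulC EFinB.
    rewrite integralB//; [|exact: real_square_integrableM kIphi qR|
      exact: real_square_integrableM kRphi qI].
    rewrite [RHS]integralB//; [|exact: real_square_integrableM kI GR|
      exact: real_square_integrableM kR GI].
    by rewrite RI IR.
Qed.

Lemma wcomp_quotientJ f x :
  om x * (f x)^*%C = (wcomp_quotient om f x)^*%C * (w x)%:C%C.
Proof.
rewrite /wcomp_quotient; have [->|omx] := eqVneq (om x) 0.
  by rewrite conjc0 !mul0r.
rewrite rmorphM fmorphV -mulcJ -mulrA [in RHS](mulrC (om x)) mulKf; first exact: mulrC.
by rewrite conjc_eq0.
Qed.

(** Formally, the adjoint of the operator is f |-> H_f.  The left-hand side is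
the inner product of g o phi and f_om in L^2(|om|^2 mu), that is, the inner
product of g and G in L^2(nu), where G is the projection of f_om; and H_f is G
times the density of [nu]. *)
Lemma wcomp_adjoint_formula (f g : X -> R[i]) : square_integrable mu f ->
    square_integrable nu g -> let H := wcomp_adjoint_fun mu phi om f in
  complex_integrable mu setT (fun x => g x * (H x)^*%C) /\
  complex_integral mu setT (fun x => om x * g (phi x) * (f x)^*%C) = cinner mu g H.
Proof.
move=> f2 g2 H; have [mH [G [G2 HG GE]]] := wcomp_adjoint_funP f2.
have [mg _] := g2; have [mG _] := G2; have [mq _] := square_integrable_quotient f2.
have mgG : measurable_fun setT (fun x => g x * (G x)^*%C).
  by apply: measurable_cM => //; exact: measurable_cconj.
have mgH : measurable_fun setT (fun x => g x * (H x)^*%C).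
  by apply: measurable_cM => //; exact: measurable_cconj.
have mgGh : measurable_fun setT (fun x => g x * (G x)^*%C * (fine_RN x)%:C%C).
  by apply: measurable_cM => //; apply: measurable_real_complex; exact: measurable_fine_RN.
have gGh : (fun x => g x * (G x)^*%C * (fine_RN x)%:C%C) =
    (fun x => g x * (H x)^*%C) %[ae mu].
  apply: filterS HG => x Hx _; by rewrite /H Hx conjc_scale [RHS]mulrCA mulrC.
split.
  apply: ae_complex_integrable gGh _ => //.
  have [iR iI] := complex_integrable_inner g2 G2.
  have dens := integrable_density measurable_fine_RN fine_RN_ge0 image_weightedE.
  split.
  - apply: eq_integrable (dens _ (measurable_Re mgG) iR) => // x _.
    by case: (g x * _) => a b /=; rewrite mulr0 subr0.
  - apply: eq_integrable (dens _ (measurable_Im mgG) iI) => // x _.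
    by case: (g x * _) => a b /=; rewrite mulr0 add0r.
rewrite /cinner -(ae_complex_integral mgGh mgH gGh).
rewrite -complex_integral_image_weighted// -[RHS]GE// complex_integral_weighted//.
  congr complex_integral; apply/funext => x.
  by rewrite mulrAC wcomp_quotientJ mulrC mulrA.
apply: measurable_cM; first exact: (measurableT_comp mg).
exact: measurable_cconj.
Qed.

(** Where h <= c, |h G|^2 <= c |G|^2 h, and G is in L^2(h dmu). *)
Lemma square_integrable_cutoff_adjoint f A c : square_integrable mu f ->
  measurable A -> 0 <= c -> (forall x, A x -> fine_RN x <= c) ->
  square_integrable mu (cutoff A (wcomp_adjoint_fun mu phi om f)).
Proof.
move=> f2 mA c0 Ac; have [mH [G [G2 HG GE]]] := wcomp_adjoint_funP f2.
have [mG iG] := G2; have mcut := measurable_cutoff mA mH; split => //.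
have mG2 := measurable_sqrE (measurable_normc mG).
have mGh : measurable_fun setT (fun x => (normc (G x) ^+ 2)%:E * (fine_RN x)%:E)%E.
  by apply: emeasurable_funM => //; apply/measurable_EFinP; exact: measurable_fine_RN.
have Gh0 x : (0 <= (normc (G x) ^+ 2)%:E * (fine_RN x)%:E)%E.
  by rewrite mule_ge0// lee_fin ?sqr_ge0// fine_RN_ge0.
apply: (@le_lt_trans _ _ (\int[mu]_x
    (c%:E * ((normc (G x) ^+ 2)%:E * (fine_RN x)%:E)))%E).
  apply: ae_ge0_le_integral => //.
  - by move=> x _; rewrite lee_fin sqr_ge0.
  - exact: measurable_sqrE (measurable_normc mcut).
  - by move=> x _; rewrite mule_ge0.
  - exact: measurable_funeM.
  - apply: filterS HG => x Hx _; rewrite /cutoff; case: ifPn => [|_]; last first.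
      by rewrite normc0 expr0n mule_ge0.
    rewrite inE => /Ac hc; rewrite Hx normc_sqrM -!EFinM lee_fin.
    have -> : normc (fine_RN x)%:C%C ^+ 2 = fine_RN x ^+ 2.
      by rewrite normc_sqr /= expr0n addr0.
    rewrite expr2 -mulrA [in leRHS](mulrC (normc _ ^+ 2)) ler_wpM2r//.
    by rewrite mulr_ge0 ?sqr_ge0 ?fine_RN_ge0.
rewrite ge0_integralZl// lte_mul_pinfty//.
rewrite -(ge0_integral_density measurable_fine_RN fine_RN_ge0 image_weightedE mG2)//.
by move=> x; rewrite lee_fin sqr_ge0.
Qed.

Lemma image_square_integralE (f : X -> R[i]) : measurable_fun setT f ->
  (\int[nu]_x (normc (f x) ^+ 2)%:E =
   \int[mu]_x ((normc (f x) ^+ 2)%:E * (fine_RN x)%:E))%E.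
Proof.
move=> mf; apply: (ge0_integral_density measurable_fine_RN fine_RN_ge0 image_weightedE).
  exact: measurable_sqrE (measurable_normc mf).
by move=> x; rewrite lee_fin sqr_ge0.
Qed.

Lemma square_integrable_image_cutoff f A c : square_integrable mu f ->
  measurable A -> 0 <= c -> (forall x, A x -> fine_RN x <= c) ->
  square_integrable nu (cutoff A f).
Proof.
move=> [mf f2] mA c0 Ac; have mcut := measurable_cutoff mA mf; split => //.
have mf2 := measurable_sqrE (measurable_normc mf).
rewrite image_square_integralE//.
apply: (@le_lt_trans _ _ (\int[mu]_x (c%:E * (normc (f x) ^+ 2)%:E))%E).
  apply: ge0_le_integral => //.
  - by move=> x _; rewrite mule_ge0// lee_fin ?sqr_ge0// fine_RN_ge0.
  - apply: emeasurable_funM; first exact: measurable_sqrE (measurable_normc mcut).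
    by apply/measurable_EFinP; exact: measurable_fine_RN.
  - exact: measurable_funeM.
  - move=> x _; rewrite -!EFinM lee_fin /cutoff; case: ifPn => [|_].
      by rewrite inE => /Ac hc; rewrite mulrC ler_wpM2r ?sqr_ge0.
    by rewrite normc0 expr0n mul0r mulr_ge0// sqr_ge0.
rewrite ge0_integralZl// ?lte_mul_pinfty//.
by move=> x _; rewrite lee_fin sqr_ge0.
Qed.

Lemma image_ae (f g : X -> R[i]) : f = g %[ae mu] -> f = g %[ae nu].
Proof. exact: null_dominates_ae_eq measurableT image_weighted_dominated. Qed.

Lemma image_square_integral_RN (f : X -> R[i]) : measurable_fun setT f ->
  (\int[nu]_x (normc (f x) ^+ 2)%:E =
   \int[mu]_x ((normc (f x) ^+ 2)%:E * wcomp_RN mu phi om x))%E.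
Proof.
move=> mf; rewrite image_square_integralE//.
have mf2 := measurable_sqrE (measurable_normc mf).
have [mh h0 _] := wcomp_RNP; apply: ge0_ae_eq_integral => //.
- by apply: emeasurable_funM => //; apply/measurable_EFinP; exact: measurable_fine_RN.
- exact: emeasurable_funM.
- by move=> x _; rewrite mule_ge0// lee_fin ?sqr_ge0// fine_RN_ge0.
- by move=> x _; rewrite mule_ge0// lee_fin sqr_ge0.
- by apply: filterS ae_fine_RN => x ->.
Qed.

(** Composition with [phi] turns a cut-off on [A] into one on phi^-1(A), so that
both sides of the adjoint relation become instances of the adjoint formula for
g cut off on [A], which is in the domain. *)
Lemma op_adjoint_cutoff (F F' U : L2 mu) A c :
  measurable A -> 0 <= c -> (forall x, A x -> fine_RN x <= c) ->
  (F' : X -> R[i]) = cutoff (phi @^-1` A) F %[ae mu] ->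
  (U : X -> R[i]) = cutoff A (wcomp_adjoint_fun mu phi om F) %[ae mu] ->
  op_adjoint (L2_inner mu) (L2_inner mu) (wcomp mu phi om) (F', U).
Proof.
move=> mA c0 Ac F'E UE [g v] [/= /wcomp_domainE g2 vE].
have F2 := L2_square_integrable F; have [mF _] := F2.
have [mH _] := wcomp_adjoint_funP F2.
have mg := L2_measurable g.
have mgphi : measurable_fun setT (fun x => om x * g (phi x)).
  by apply: measurable_cM => //; exact: (measurableT_comp mg).
have mcF : measurable_fun setT (cutoff (phi @^-1` A) F).
  by apply: measurable_cutoff => //; exact: mphiI.
have mcH := measurable_cutoff mA mH.
have cg2 : square_integrable nu (cutoff A g).
  exact: square_integrable_cutoff g2.
rewrite !L2_cinner.
rewrite (ae_cinner (L2_measurable v) mgphi (L2_measurable F') mcF vE F'E).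
rewrite (ae_cinner mg mg (L2_measurable U) mcH (ae_eq_refl _ _ _) UE).
have [_ cgE] := wcomp_adjoint_formula F2 cg2.
rewrite [LHS](_ : _ = complex_integral mu setT
    (fun x => om x * cutoff A g (phi x) * (F x)^*%C)); last first.
  congr complex_integral; apply/funext => x; rewrite /cutoff.
  rewrite (_ : (x \in phi @^-1` A) = (phi x \in A)); last by apply/idP/idP; rewrite !inE.
  by case: (phi x \in A); rewrite ?conjc0 ?mulr0 ?mul0r.
rewrite cgE; congr complex_integral; apply/funext => x; rewrite /cutoff.
by case: (x \in A); rewrite ?conjc0 ?mulr0 ?mul0r.
Qed.

(** A limit point (g, v) of the graph satisfies the adjoint relation with the
explicit elements of the graph of the adjoint given by [op_adjoint_cutoff].  By
the adjoint formula, v and om * (g o phi), both cut off on phi^-1(A_k), have the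
same inner product with every function, in particular with their difference. *)
Lemma closed_wcomp : closed (wcomp mu phi om).
Proof.
move=> [g v] gv.
pose A k := [set x | fine_RN x <= k%:R].
have mA k : measurable (A k).
  rewrite -[X in measurable X]setTI; apply: measurable_fun_le => //.
  exact: measurable_fine_RN.
have Ac k x : A k x -> fine_RN x <= k%:R by [].
have mv := L2_measurable v; have mg := L2_measurable g.
have g2 := L2_square_integrable g; have v2 := L2_square_integrable v.
have mgphi : measurable_fun setT (fun x => om x * g (phi x)).
  by apply: measurable_cM => //; exact: (measurableT_comp mg).
have vA k : cutoff (phi @^-1` A k) v =
    cutoff (phi @^-1` A k) (fun x => om x * g (phi x)) %[ae mu].
  have mpA := mphiI (mA k).
  have cg2 : square_integrable nu (cutoff (A k) g).
    exact: square_integrable_image_cutoff g2 (mA k) (ler0n R k) (Ac k).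
  have cV2 := square_integrable_cutoff mpA v2.
  have mcg : measurable_fun setT (cutoff (A k) g) by exact: measurable_cutoff.
  pose W x := om x * cutoff (A k) g (phi x).
  have WE : W = cutoff (phi @^-1` A k) (fun x => om x * g (phi x)).
    apply/funext => x; rewrite /W /cutoff.
    rewrite (_ : (x \in phi @^-1` A k) = (phi x \in A k)).
      by case: ifP; rewrite ?mulr0.
    by apply/idP/idP; rewrite !inE.
  have W2 : square_integrable mu W by apply/wcomp_square_integrable.
  have D2 := square_integrableB cV2 W2.
  have [F FE] := L2_exists D2.
  have F2 := L2_square_integrable F; have [mF _] := F2.
  have cF2 := square_integrable_cutoff mpA F2.
  have [F' F'E] := L2_exists cF2.
  have cH2 := square_integrable_cutoff_adjoint F2 (mA k) (ler0n R k) (Ac k).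
  have [U UE] := L2_exists cH2.
  have adj := op_adjoint_cutoff (mA k) (ler0n R k) (Ac k) F'E UE.
  have : [set p : L2 mu * L2 mu | L2_inner mu p.2 F' = L2_inner mu p.1 U] (g, v).
    apply: closed_adjoint_pair => B /gv [p [pC pB]]; exists p; split => //.
    exact: adj.
  rewrite /= !L2_cinner.
  rewrite (ae_cinner mv mv (L2_measurable F') cF2.1 (ae_eq_refl _ _ _) F'E).
  rewrite (ae_cinner mg mg (L2_measurable U) cH2.1 (ae_eq_refl _ _ _) UE).
  rewrite [LHS](_ : _ = cinner mu (cutoff (phi @^-1` A k) v) F); last first.
    congr complex_integral; apply/funext => x; rewrite /cutoff.
    by case: ifP; rewrite ?conjc0 ?mulr0 ?mul0r.
  rewrite [RHS](_ : _ =
      cinner mu (cutoff (A k) g) (wcomp_adjoint_fun mu phi om F)); last first.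
    congr complex_integral; apply/funext => x; rewrite /cutoff.
    by case: ifP; rewrite ?conjc0 ?mulr0 ?mul0r.
  have [_ <-] := wcomp_adjoint_formula F2 cg2.
  rewrite -[RHS]/(cinner mu W F) => VW; rewrite -WE.
  have /cinner_eq0 : cinner mu (fun x => cutoff (phi @^-1` A k) v x - W x)
      (fun x => cutoff (phi @^-1` A k) v x - W x) = 0.
    rewrite -[LHS](ae_cinner D2.1 D2.1 mF D2.1 (ae_eq_refl _ _ _) FE).
    by rewrite cinnerBl// VW subrr.
  move=> /(_ D2); apply: filterS => x /= + _ => /(_ I) /eqP.
  by rewrite subr_eq0 => /eqP.
have vE : (v : X -> R[i]) = (fun x => om x * g (phi x)) %[ae mu].
  have /ae_foralln := vA; apply: filterS => x vAx _.
  have := vAx (Num.truncn (fine_RN (phi x))).+1 I.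
  rewrite /cutoff mem_set//= /A /=.
  exact/ltW/truncnS_gt.
split => //=; exact: ae_square_integrable mgphi vE v2.
Qed.

End weighted_composition_operator.

(** * The column operator of a pair *)

Section pair.
Context d (X : measurableType d) (R : realType).
Variables (mu : {sigma_finite_measure set X -> \bar R}).
Variables (phi1 phi2 : {mfun X >-> X}) (om1 om2 : {mfun X >-> R[i]}).
Variables (nu1 nu2 : {measure set X -> \bar R}).
Hypothesis nu1E : forall A, nu1 A = weighted_measure mu om1 (phi1 @^-1` A).
Hypothesis nu2E : forall A, nu2 A = weighted_measure mu om2 (phi2 @^-1` A).
Hypothesis wd1 : wcomp_well_defined mu phi1 om1.
Hypothesis wd2 : wcomp_well_defined mu phi2 om2.
Hypothesis sfin1 : sigma_finite setT nu1.
Hypothesis sfin2 : sigma_finite setT nu2.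

Let C := op_column (wcomp mu phi1 om1) (wcomp mu phi2 om2).
Let adj := op_adjoint (L2_inner mu) (L2_inner mu).
Let Cstar := op_adjoint (L2_inner mu) (L2_inner2 mu) C.
Let row := op_row (adj (wcomp mu phi1 om1)) (adj (wcomp mu phi2 om2)).
Let H1 f := wcomp_adjoint_fun mu phi1 om1 f.
Let H2 f := wcomp_adjoint_fun mu phi2 om2 f.
(* The functions under consideration are square-integrable on each A k. *)
Let A k := [set x | fine_RN mu phi1 om1 x <= k%:R] `&`
           [set x | fine_RN mu phi2 om2 x <= k%:R].

Let mA k : measurable (A k).
Proof.
apply: measurableI; rewrite -[X in measurable X]setTI;
  apply: measurable_fun_le => //; [exact: measurable_fine_RN nu1E wd1 sfin1|
    exact: measurable_fine_RN nu2E wd2 sfin2].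
Qed.

Let A1 k x : A k x -> fine_RN mu phi1 om1 x <= k%:R. Proof. by case. Qed.
Let A2 k x : A k x -> fine_RN mu phi2 om2 x <= k%:R. Proof. by case. Qed.

Let ndA : nondecreasing_seq A.
Proof.
move=> i j ij; apply/subsetPset => x [x1 x2].
by split; [apply: le_trans x1 _|apply: le_trans x2 _]; rewrite ler_nat.
Qed.

Let TA : \bigcup_k A k = setT.
Proof.
rewrite -subTset => x _.
exists (maxn (Num.truncn (fine_RN mu phi1 om1 x)).+1
  (Num.truncn (fine_RN mu phi2 om2 x)).+1) => //.
split=> /=; apply: le_trans (ltW (truncnS_gt _)) _; rewrite ler_nat.
- exact: leq_maxl.
- exact: leq_maxr.
Qed.

Let preA (phi : {mfun X >-> X}) : [/\ forall k, measurable (phi @^-1` A k),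
  nondecreasing_seq (fun k => phi @^-1` A k) & \bigcup_k (phi @^-1` A k) = setT].
Proof.
split.
- move=> k; rewrite -[X in measurable X]setTI.
  by apply: (@measurable_funPT _ _ _ _ phi) => //; exact: mA.
- move=> i j ij; apply/subsetPset => x; have /subsetPset := ndA ij; exact.
- by rewrite -preimage_bigcup TA preimage_setT.
Qed.

Lemma op_domain_columnE (F : L2 mu) : op_domain C F <->
  square_integrable nu1 F /\ square_integrable nu2 F.
Proof.
split=> [[v [[/= D1 _] [/= D2 _]]]|[F1 F2]].
  by split; [exact/(wcomp_domainE nu1E)|exact/(wcomp_domainE nu2E)].
have /(wcomp_domainE nu1E) D1 := F1; have /(wcomp_domainE nu2E) D2 := F2.
have [v1 v1E] := L2_exists D1; have [v2 v2E] := L2_exists D2.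
by exists (v1, v2); split; split.
Qed.

Lemma op_domain_column_weighted : op_domain C = weighted_L2 mu
  (fun x => 1 + wcomp_RN mu phi1 om1 x + wcomp_RN mu phi2 om2 x)%E.
Proof.
have [mh1 h10 _] := wcomp_RNP nu1E wd1 sfin1.
have [mh2 h20 _] := wcomp_RNP nu2E wd2 sfin2.
apply/seteqP; split => F; rewrite op_domain_columnE /weighted_L2 /=.
all: have mF := L2_measurable F; have [_ F2] := L2_square_integrable F.
all: have mF2 := measurable_sqrE (measurable_normc mF).
all: have F20 x : (0 <= (normc (F x) ^+ 2)%:E)%E by rewrite lee_fin sqr_ge0.
all: rewrite /square_integrable.
all: rewrite (image_square_integral_RN nu1E wd1 sfin1 mF).
all: rewrite (image_square_integral_RN nu2E wd2 sfin2 mF).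
- move=> [[_ F1] [_ F2']].
  under eq_integral => x _ do rewrite !ge0_muleDr ?adde_ge0// mule1.
  have m1 := emeasurable_funM mF2 mh1; have m2 := emeasurable_funM mF2 mh2.
  have p1 x : (0 <= (normc (F x) ^+ 2)%:E * wcomp_RN mu phi1 om1 x)%E.
    by rewrite mule_ge0.
  have p2 x : (0 <= (normc (F x) ^+ 2)%:E * wcomp_RN mu phi2 om2 x)%E.
    by rewrite mule_ge0.
  rewrite ge0_integralD//; last 2 first.
  + by move=> x _; rewrite adde_ge0.
  + exact: emeasurable_funD.
  rewrite ge0_integralD//.
  exact: lte_add_pinfty (lte_add_pinfty F2 F1) F2'.
- move=> Foo; have mtot : measurable_fun setT (fun x => (normc (F x) ^+ 2)%:E *
      (1 + wcomp_RN mu phi1 om1 x + wcomp_RN mu phi2 om2 x))%E.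
    by apply: emeasurable_funM => //; apply: emeasurable_funD => //;
      exact: emeasurable_funD.
  split; split => //; apply: le_lt_trans Foo; apply: ge0_le_integral => //.
  + by move=> x _; rewrite mule_ge0.
  + exact: emeasurable_funM.
  + move=> x _; apply: lee_wpmul2l => //.
    by rewrite -addeA addeCA leeDl// adde_ge0.
  + by move=> x _; rewrite mule_ge0.
  + exact: emeasurable_funM.
  + move=> x _; apply: lee_wpmul2l => //.
    by rewrite leeDr// adde_ge0.
Qed.

Lemma cutoff_op_domain (F FA : L2 mu) k :
  (FA : X -> R[i]) = cutoff (A k) F %[ae mu] -> op_domain C FA.
Proof.
move=> FAE; have F2 := L2_square_integrable F; have mFA := L2_measurable FA.
apply/op_domain_columnE; split; apply: ae_square_integrable mFA _ _.
- exact: (ae_eq_sym (image_ae nu1E wd1 FAE)).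
- exact: (square_integrable_image_cutoff nu1E wd1 sfin1 F2 (mA k) (ler0n R k) (@A1 k)).
- exact: (ae_eq_sym (image_ae nu2E wd2 FAE)).
- exact: (square_integrable_image_cutoff nu2E wd2 sfin2 F2 (mA k) (ler0n R k) (@A2 k)).
Qed.

Lemma dense_op_domain_column : closure (op_domain C) = setT.
Proof.
rewrite -subTset => F _.
have F2 := L2_square_integrable F.
have [FA FAE] := choice (fun k => L2_exists (square_integrable_cutoff (mA k) F2)).
apply: (closed_cvg _ (@closed_closure _ (op_domain C)) _ _
  (cutoff_cvg mA ndA TA FAE)).
by apply: nearW => k; apply: subset_closure; exact: cutoff_op_domain (FAE k).
Qed.

Lemma closed_column : closed C.
Proof.
have c (U V W : topologicalType) (g : U -> V) (h : U -> W) : continuous g ->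
    continuous h -> continuous (fun x => (g x, h x)).
  by move=> cg ch x; exact: cvg_pair (cg x) (ch x).
rewrite (_ : C =
  (fun p : L2 mu * (L2 mu * L2 mu) => (p.1, p.2.1)) @^-1` wcomp mu phi1 om1 `&`
  (fun p => (p.1, p.2.2)) @^-1` wcomp mu phi2 om2)//.
apply: closedI.
- apply: preimage_closed => [p _|]; last exact: closed_wcomp nu1E wd1 sfin1.
  apply: c => q; first exact: cvg_fst.
  exact: (continuous_comp cvg_snd cvg_fst).
- apply: preimage_closed => [p _|]; last exact: closed_wcomp nu2E wd2 sfin2.
  apply: c => q; first exact: cvg_fst.
  exact: (continuous_comp cvg_snd cvg_snd).
Qed.

Lemma adjoint_column_pairing (F1 F2 g : L2 mu) : square_integrable nu1 g ->
    square_integrable nu2 g ->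
  complex_integral mu setT (fun x => om1 x * g (phi1 x) * (F1 x)^*%C) +
  complex_integral mu setT (fun x => om2 x * g (phi2 x) * (F2 x)^*%C) =
  cinner mu g (fun x => H1 F1 x + H2 F2 x).
Proof.
move=> g1 g2.
have [i1 ->] := wcomp_adjoint_formula nu1E wd1 sfin1 (L2_square_integrable F1) g1.
have [i2 ->] := wcomp_adjoint_formula nu2E wd2 sfin2 (L2_square_integrable F2) g2.
rewrite -complex_integralD//; congr complex_integral; apply/funext => x.
by rewrite rmorphD mulrDr.
Qed.

Lemma columnE (g v1 v2 F1 F2 : L2 mu) : C (g, (v1, v2)) ->
  L2_inner2 mu (v1, v2) (F1, F2) = cinner mu g (fun x => H1 F1 x + H2 F2 x).
Proof.
move=> Cg; have /op_domain_columnE[g1 g2] : op_domain C g by exists (v1, v2).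
have [[/= _ v1E] [/= _ v2E]] := Cg.
rewrite -adjoint_column_pairing// /L2_inner2 /= !L2_cinner.
have mg := L2_measurable g.
have mgphi (phi : {mfun X >-> X}) (om : {mfun X >-> R[i]}) :
    measurable_fun setT (fun x => om x * g (phi x)).
  apply: measurable_cM; first exact: measurable_funPT.
  by apply: (measurableT_comp mg); exact: measurable_funPT.
rewrite (ae_cinner (L2_measurable v1) (mgphi _ _) (L2_measurable F1)
  (L2_measurable F1) v1E (ae_eq_refl _ _ _)).
by rewrite (ae_cinner (L2_measurable v2) (mgphi _ _) (L2_measurable F2)
  (L2_measurable F2) v2E (ae_eq_refl _ _ _)).
Qed.

Let mH (F1 F2 : L2 mu) : measurable_fun setT (H1 F1) /\ measurable_fun setT (H2 F2).
Proof.
have [m1 _] := wcomp_adjoint_funP nu1E wd1 sfin1 (L2_square_integrable F1).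
have [m2 _] := wcomp_adjoint_funP nu2E wd2 sfin2 (L2_square_integrable F2).
exact: (conj m1 m2).
Qed.

(** The test function is H1 F1 + H2 F2 - u cut off on A_k, which is in the
domain of the column because the densities are bounded on A_k. *)
Lemma adjoint_column_value (F1 F2 u : L2 mu) : Cstar ((F1, F2), u) ->
  (fun x => H1 F1 x + H2 F2 x) = u %[ae mu].
Proof.
move=> Cs; have [m1 m2] := mH F1 F2; have u2 := L2_square_integrable u.
have mu_ := L2_measurable u.
have mHH := measurable_cD m1 m2.
suff HA k : cutoff (A k) (fun x => H1 F1 x + H2 F2 x - u x) = cst 0 %[ae mu].
  have /ae_foralln := HA; apply: filterS => x Hx _.
  have [k _ Akx] : (\bigcup_k A k) x by rewrite TA.
  by have /eqP := Hx k I; rewrite /cutoff mem_set//= subr_eq0 => /eqP.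
have cH1 := square_integrable_cutoff_adjoint nu1E wd1 sfin1
  (L2_square_integrable F1) (mA k) (ler0n R k) (@A1 k).
have cH2 := square_integrable_cutoff_adjoint nu2E wd2 sfin2
  (L2_square_integrable F2) (mA k) (ler0n R k) (@A2 k).
have cHH : square_integrable mu (cutoff (A k) (fun x => H1 F1 x + H2 F2 x)).
  rewrite (_ : cutoff _ _ = fun x => cutoff (A k) (H1 F1) x + cutoff (A k) (H2 F2) x).
    exact: square_integrableD cH1 cH2.
  by apply/funext => x; rewrite /cutoff; case: ifP; rewrite ?addr0.
have cu := square_integrable_cutoff (mA k) u2.
pose D x := cutoff (A k) (fun x => H1 F1 x + H2 F2 x) x - cutoff (A k) u x.
have DE : cutoff (A k) (fun x => H1 F1 x + H2 F2 x - u x) = D.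
  by apply/funext => x; rewrite /D /cutoff; case: ifP; rewrite ?subr0.
have D2 : square_integrable mu D by exact: square_integrableB.
rewrite DE; apply: cinner_eq0 => //.
have [g gE] := L2_exists D2.
have gE' : (g : X -> R[i]) = cutoff (A k) g %[ae mu].
  apply: filterS gE => x /= /(_ I) gx _; rewrite /cutoff; case: ifPn => // xA.
  by rewrite gx /D /cutoff (negbTE xA) subrr.
have [[v1 v2] Cg] := cutoff_op_domain gE'.
have g2 := L2_square_integrable g; have mg := L2_measurable g.
have := Cs _ Cg; rewrite /= (columnE F1 F2 Cg) L2_cinner => e.
have cut f : square_integrable mu (cutoff (A k) f) -> measurable_fun setT f ->
    cinner mu g f = cinner mu g (cutoff (A k) f).
  move=> [mcf _] mf; apply: ae_complex_integral.
  - by apply: measurable_cM => //; exact: measurable_cconj.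
  - by apply: measurable_cM => //; exact: measurable_cconj.
  apply: filterS gE' => x /= /(_ I) -> _; rewrite /cutoff.
  by case: ifP; rewrite ?mul0r ?conjc0 ?mulr0.
rewrite -(ae_cinner mg D2.1 D2.1 D2.1 gE (ae_eq_refl _ _ _)).
by rewrite cinnerBr// -cut// -[X in _ - X]cut// e subrr.
Qed.

Lemma adjoint_column_domain :
  op_domain Cstar = [set f : L2 mu * L2 mu | square_integrable mu
    (fun x => H1 f.1 x + H2 f.2 x)].
Proof.
apply/seteqP; split=> -[F1 F2] /=.
  move=> [u /adjoint_column_value uE]; have [m1 m2] := mH F1 F2.
  apply: (ae_square_integrable (measurable_cD m1 m2) (ae_eq_sym uE)).
  exact: L2_square_integrable.
move=> HH2; have [u uE] := L2_exists HH2; exists u => -[g [v1 v2]] Cg /=.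
rewrite (columnE F1 F2 Cg) L2_cinner.
apply: (ae_cinner (L2_measurable g) (L2_measurable g) HH2.1 (L2_measurable u)).
  exact: ae_eq_refl.
exact: ae_eq_sym.
Qed.

Lemma row_sub_adjoint_column : row `<=` Cstar.
Proof.
move=> [[F1 F2] u] [g1 [g2 [/= a1 a2 uE]]] [g [v1 v2]] [/= c1 c2].
rewrite /L2_inner2 /= (a1 _ c1) (a2 _ c2) /= !L2_cinner.
have [mg1 mg2] := (L2_measurable g1, L2_measurable g2).
have mg := L2_measurable g.
rewrite [RHS](ae_cinner mg mg (L2_measurable u) (measurable_cD mg1 mg2)
  (ae_eq_refl _ _ _) uE).
by rewrite cinnerDr//; exact: L2_square_integrable.
Qed.

Lemma closed_adjoint_column : closed Cstar.
Proof.
rewrite (_ : Cstar = \bigcap_(p in C) [set q : (L2 mu * L2 mu) * L2 mu |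
    L2_inner2 mu (p.2.1, p.2.2) q.1 = L2_inner mu p.1 q.2]).
  by apply: closed_bigI => p _; exact: closed_adjoint_pair2.
by apply/seteqP; split => q Cq [g [v1 v2]] /Cq.
Qed.

(** Given (f_1, f_2) in the domain of the adjoint with value u, the row operator
maps the f_i cut off on phi_i^-1(A_k) to u cut off on A_k. *)
Lemma adjoint_column_row : Cstar = closure row.
Proof.
apply/seteqP; split; last first.
  rewrite [X in _ `<=` X]((closure_id Cstar).1 closed_adjoint_column).
  exact: closureS row_sub_adjoint_column.
move=> [[F1 F2] u] Cs; have uE := adjoint_column_value Cs.
have F12 := L2_square_integrable F1; have F22 := L2_square_integrable F2.
have u2 := L2_square_integrable u.
have [mp1 nd1 T1] := preA phi1; have [mp2 nd2 T2] := preA phi2.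
have [G1 G1E] := choice (fun k => L2_exists (square_integrable_cutoff (mp1 k) F12)).
have [G2 G2E] := choice (fun k => L2_exists (square_integrable_cutoff (mp2 k) F22)).
have [w wE] := choice (fun k => L2_exists (square_integrable_cutoff (mA k) u2)).
have c1 := cutoff_cvg mp1 nd1 T1 G1E.
have c2 := cutoff_cvg mp2 nd2 T2 G2E.
have c3 := cutoff_cvg mA ndA TA wE.
have cv : ((G1 k, G2 k), w k) @[k --> \oo] --> ((F1, F2), u).
  exact: (cvg_pair (cvg_pair c1 c2) c3).
apply: (closed_cvg _ (@closed_closure _ row) _ _ cv).
apply: nearW => k; apply: subset_closure.
have cH1 := square_integrable_cutoff_adjoint nu1E wd1 sfin1
  F12 (mA k) (ler0n R k) (@A1 k).
have cH2 := square_integrable_cutoff_adjoint nu2E wd2 sfin2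
  F22 (mA k) (ler0n R k) (@A2 k).
have [U1 U1E] := L2_exists cH1; have [U2 U2E] := L2_exists cH2.
exists U1, U2; split => /=.
- exact: (op_adjoint_cutoff nu1E wd1 sfin1 (mA k) (ler0n R k) (@A1 k) (G1E k) U1E).
- exact: (op_adjoint_cutoff nu2E wd2 sfin2 (mA k) (ler0n R k) (@A2 k) (G2E k) U2E).
- have U12 : (fun x => U1 x + U2 x) = cutoff (A k) u %[ae mu].
    apply: filterS3 U1E U2E uE => x /= /(_ I) U1x /(_ I) U2x /(_ I) ux _.
    rewrite U1x U2x /cutoff; case: ifP => _; [exact: ux|exact: addr0].
  exact: ae_eq_trans (wE k) (ae_eq_sym U12).
Qed.

End pair.

Theorem proposition3 (R : realType) (d : measure_display)
    (X : measurableType d) (mu : {sigma_finite_measure set X -> \bar R})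
    (phi1 phi2 : {mfun X >-> X}) (om1 om2 : {mfun X >-> R[i]}) :
  wcomp_well_defined mu phi1 om1 ->
  wcomp_well_defined mu phi2 om2 ->
  closure (op_domain (wcomp mu phi1 om1)) = setT ->
  closure (op_domain (wcomp mu phi2 om2)) = setT ->
  let C1 := wcomp mu phi1 om1 in
  let C2 := wcomp mu phi2 om2 in
  let h1 := wcomp_RN mu phi1 om1 in
  let h2 := wcomp_RN mu phi2 om2 in
  let C := op_column C1 C2 in
  let adj := op_adjoint (L2_inner mu) (L2_inner mu) in
  let Cstar := op_adjoint (L2_inner mu) (L2_inner2 mu) C in
  [/\ op_domain C = weighted_L2 mu (fun x => 1 + h1 x + h2 x)%E,
      closure (op_domain C) = setT,
      closed C,
      Cstar = closure (op_row (adj C1) (adj C2)) &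
      op_domain Cstar = [set f : L2 mu * L2 mu | square_integrable mu
        (fun x => wcomp_adjoint_fun mu phi1 om1 f.1 x +
                  wcomp_adjoint_fun mu phi2 om2 f.2 x)]].
Proof.
move=> wd1 wd2 dense1 dense2 C1 C2 h1 h2 C adj Cstar.
have [nu1 nu1E] := image_measure_exists (weighted_measure mu om1) phi1.
have [nu2 nu2E] := image_measure_exists (weighted_measure mu om2) phi2.
have sfin1 := dense_domain_sigma_finite nu1E wd1 dense1.
have sfin2 := dense_domain_sigma_finite nu2E wd2 dense2.
split.
- exact: op_domain_column_weighted nu1E nu2E wd1 wd2 sfin1 sfin2.
- exact: dense_op_domain_column nu1E nu2E wd1 wd2 sfin1 sfin2.
- exact: closed_column nu1E nu2E wd1 wd2 sfin1 sfin2.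
- exact: adjoint_column_row nu1E nu2E wd1 wd2 sfin1 sfin2.
- exact: adjoint_column_domain nu1E nu2E wd1 wd2 sfin1 sfin2.
Qed.
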